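(* For all $k$-partite states $\rho,\sigma$, \[ R_{\mathrm{LOCCq}}(\rho,\sigma)=\inf_{\substack{E\in\mathcal{F}_k\\ E(\sigma)\neq0}}\frac{E(\rho)}{E(\sigma)}. \]
   Context: A $k$-partite state is a density operator on $\mathcal{H}_1\otimes\cdots\otimes\mathcal{H}_k$ (finite-dimensional factors); tensor products group corresponding factors. $\mathrm{GHZ}$ is the state with vector $2^{-1/2}(|0\ldots0\rangle+|1\ldots1\rangle)\in(\mathbb{C}^2)^{\otimes k}$. Purified distance $D(\rho,\sigma)=\sqrt{1-F(\rho,\sigma)^2}$, $F(\rho,\sigma)=\operatorname{Tr}\sqrt{\sigma^{1/2}\rho\sigma^{1/2}}$; $\rho\to_\epsilon\sigma$ means some LOCC channel $\Lambda$ has $D(\Lambda(\rho),\sigma)\le\epsilon$. Write $\rho\ge\sigma$ iff $\limsup_{n\to\infty}\inf\{\epsilon\ge0:\rho^{\otimes n}\to_\epsilon\sigma^{\otimes n}\}=0$. $\mathcal{F}_k$ is the set of maps $E$ from $k$-partite states (of all finite dimensions) to $\mathbb{R}$ such that $E(\mathrm{GHZ})=1$, $E(\rho\otimes\sigma)=E(\rho)+E(\sigma)$ for all $\rho,\sigma$, and $\rho\ge\sigma$ implies $E(\rho)\ge E(\sigma)$. $r\ge0$ is an achievable rate if for every $\delta>0$, $\limsup_{n\to\infty}\inf\{\epsilon\ge0:\rho^{\otimes n}\otimes\mathrm{GHZ}^{\otimes\lfloor\delta n\rfloor}\to_\epsilon\sigma^{\otimes\lceil rn\rceil}\}=0$;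 $R_{\mathrm{LOCCq}}(\rho,\sigma)$ is the supremum of achievable rates. The infimum over an empty set is $+\infty$. *)

(* Defs.v *)
From HB Require Import structures.
From mathcomp Require Import all_boot all_order all_algebra.
From mathcomp Require Import complex mxtens.
From mathcomp Require Import classical_sets boolp reals ereal sequences Rstruct.
From Stdlib Require Import ClassicalEpsilon.

Set Implicit Arguments.
Unset Strict Implicit.
Unset Printing Implicit Defensive.

Import Order.TTheory GRing.Theory Num.Theory.
Local Open Scope ring_scope.

Definition Rr := Rdefinitions.R.
Definition C := complex Rr.

Definition Op (T : finType) := T -> T -> C.

Definition opmul (T : finType) (A B : Op T) : Op T :=
  fun x y => \sum_(z : T) A x z * B z y.

Definition tr (T : finType) (A : Op T) : C := \sum_(x : T) A x x.

Definition psd (T : finType) (A : Op T) : Prop :=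
  forall v : T -> C, 0 <= \sum_(x : T) \sum_(y : T) (v x)^* * A x y * v y.

Definition is_state (T : finType) (A : Op T) : Prop := psd A /\ tr A = 1.

Definition sqrtm (T : finType) (A : Op T) : Op T :=
  epsilon (inhabits (fun _ _ => 0)) (fun B : Op T => psd B /\ opmul B B = A).

Definition fidelity (T : finType) (rho sigma : Op T) : Rr :=
  complex.Re (tr (sqrtm (opmul (opmul (sqrtm sigma) rho) (sqrtm sigma)))).

Definition pdist (T : finType) (rho sigma : Op T) : Rr :=
  Num.sqrt (1 - fidelity rho sigma ^+ 2).

(* local dimensions d : 'I_k -> nat; global basis = tuples of local basis indices *)
Definition Idx (k : nat) (d : 'I_k -> nat) : finType := {dffun forall i : 'I_k, 'I_(d i)}.

Definition kOp (k : nat) (d : 'I_k -> nat) := Op (Idx d).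

(* tensor product, grouping corresponding factors: C^{d i} (x) C^{e i} = C^{d i * e i} *)
Definition tens (k : nat) (d e : 'I_k -> nat) (rho : kOp d) (sigma : kOp e)
  : kOp (fun i => d i * e i) :=
  fun x y =>
    rho (@finfun _ (fun i => 'I_(d i)) (fun i => (mxtens_unindex (x i)).1))
        (@finfun _ (fun i => 'I_(d i)) (fun i => (mxtens_unindex (y i)).1)) *
    sigma (@finfun _ (fun i => 'I_(e i)) (fun i => (mxtens_unindex (x i)).2))
          (@finfun _ (fun i => 'I_(e i)) (fun i => (mxtens_unindex (y i)).2)).

Fixpoint pdim (a n : nat) : nat := match n with 0 => 1 | S n => a * pdim a n end.

(* tensor power rho^{(x) n}; rho^{(x) 0} is the trivial state on (C^1)^{(x) k} *)
Fixpoint tpow (k : nat) (d : 'I_k -> nat) (rho : kOp d) (n : nat)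
  : kOp (fun i => pdim (d i) n) :=
  match n as m return kOp (fun i => pdim (d i) m) with
  | 0 => fun _ _ => 1
  | S m => tens rho (@tpow k d rho m)
  end.
Arguments tpow {k d} rho n.

(* GHZ state |GHZ><GHZ|, |GHZ> = 2^{-1/2}(|0...0> + |1...1>) in (C^2)^{(x) k} *)
Definition ghz_supp (k : nat) (x : Idx (fun _ : 'I_k => 2)) : bool :=
  [forall i, val (x i) == 0%N] || [forall i, val (x i) == 1%N].

Definition GHZ (k : nat) : kOp (fun _ : 'I_k => 2) :=
  fun x y => if ghz_supp x && ghz_supp y then 2^-1 else 0.
Arguments GHZ : clear implicits.

Definition adjmx (m n : nat) (K : 'M[C]_(m, n)) : 'M[C]_(n, m) := map_mx Num.conj K^T.

Definition lcp (m n : nat) (Ks : seq 'M[C]_(n, m)) (A : 'M[C]_m) : 'M[C]_n :=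
  \sum_(K <- Ks) K *m A *m adjmx K.

Definition kraus_sum (m n : nat) (Ks : seq 'M[C]_(n, m)) : 'M[C]_m :=
  \sum_(K <- Ks) adjmx K *m K.

(* product of local linear maps Phi_1 (x) ... (x) Phi_k acting on a k-partite operator *)
Definition prodmap (k : nat) (d e : 'I_k -> nat)
  (Phi : forall i : 'I_k, 'M[C]_(d i) -> 'M[C]_(e i)) (rho : kOp d) : kOp e :=
  fun a b => \sum_(x : Idx d) \sum_(y : Idx d)
     rho x y * \prod_(i : 'I_k) Phi i (delta_mx (x i) (y i)) (a i) (b i).

(* Finite-round LOCC instruments (outcome set O, one CP map per outcome), generated by
   - a round: party j performs a local instrument (Kraus operators K o j) and broadcasts
     the outcome o, while every other party i applies a fixed local channel (K o i,
     independent of o);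
   - adaptive sequential composition (the second instrument may depend on the first outcome);
   - coarse-graining of outcomes. *)
Inductive LOCCinstr (k : nat) :
  forall (d e : 'I_k -> nat) (O : finType), (O -> kOp d -> kOp e) -> Prop :=
| LOCC_round (d e : 'I_k -> nat) (O : finType) (j : 'I_k)
    (K : O -> forall i : 'I_k, seq 'M[C]_(e i, d i)) :
    (forall i, i != j -> forall o o', K o i = K o' i) ->
    (forall i, i != j -> forall o, kraus_sum (K o i) = 1%:M) ->
    \sum_(o : O) kraus_sum (K o j) = 1%:M ->
    LOCCinstr (fun o => prodmap (fun i => lcp (K o i)))
| LOCC_seq (d m e : 'I_k -> nat) (O1 O2 : finType)
    (I1 : O1 -> kOp d -> kOp m) (I2 : O1 -> O2 -> kOp m -> kOp e) :
    LOCCinstr I1 -> (forall o1, LOCCinstr (I2 o1)) ->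
    LOCCinstr (fun o : O1 * O2 => fun rho => I2 o.1 o.2 (I1 o.1 rho))
| LOCC_coarse (d e : 'I_k -> nat) (O O' : finType) (f : O -> O')
    (I : O -> kOp d -> kOp e) :
    LOCCinstr I ->
    LOCCinstr (fun o' rho => fun a b => \sum_(o : O | f o == o') I o rho a b).

Definition LOCCchannel (k : nat) (d e : 'I_k -> nat) (L : kOp d -> kOp e) : Prop :=
  @LOCCinstr k d e unit (fun _ => L).

Definition transf (k : nat) (d e : 'I_k -> nat) (rho : kOp d) (sigma : kOp e) (eps : Rr)
  : Prop :=
  exists L : kOp d -> kOp e, LOCCchannel L /\ pdist (L rho) sigma <= eps.

(* inf { eps >= 0 : rho ->_eps sigma } in the extended reals (inf of empty set = +oo) *)
Definition opt_err (k : nat) (d e : 'I_k -> nat) (rho : kOp d) (sigma : kOp e) : \bar Rr :=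
  ereal_inf [set eps%:E | eps in [set eps : Rr | 0 <= eps /\ transf rho sigma eps]].

Definition asym_geq (k : nat) (d e : 'I_k -> nat) (rho : kOp d) (sigma : kOp e) : Prop :=
  limn_esup (fun n => opt_err (tpow rho n) (tpow sigma n)) = 0%E.

Definition kfun (k : nat) := forall d : 'I_k -> nat, kOp d -> Rr.

Definition Fk (k : nat) : set (kfun k) :=
  [set E : kfun k | E _ (GHZ k) = 1
         /\ (forall (d e : 'I_k -> nat) (rho : kOp d) (sigma : kOp e),
               is_state rho -> is_state sigma ->
               E _ (tens rho sigma) = E _ rho + E _ sigma)
         /\ (forall (d e : 'I_k -> nat) (rho : kOp d) (sigma : kOp e),
               is_state rho -> is_state sigma -> asym_geq rho sigma ->
               E _ sigma <= E _ rho)].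

(* floor (for nonnegative arguments) and ceiling as natural numbers *)
Definition nfloor (x : Rr) : nat := Num.truncn x.
Definition nceil (x : Rr) : nat := `|Num.ceil x|%N.

Definition achievable (k : nat) (d e : 'I_k -> nat) (rho : kOp d) (sigma : kOp e) (r : Rr)
  : Prop :=
  0 <= r /\
  forall delta : Rr, 0 < delta ->
    limn_esup (fun n =>
      opt_err (tens (tpow rho n) (tpow (GHZ k) (nfloor (delta * n%:R))))
              (tpow sigma (nceil (r * n%:R)))) = 0%E.

Definition R_LOCCq (k : nat) (d e : 'I_k -> nat) (rho : kOp d) (sigma : kOp e) : \bar Rr :=
  ereal_sup [set r%:E | r in [set r : Rr | achievable rho sigma r]].

(* Main.v *)
Require Import Defs.
From HB Require Import structures.
From mathcomp Require Import all_boot all_order all_algebra.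
From mathcomp Require Import complex mxtens.
From mathcomp Require Import classical_sets boolp reals ereal sequences Rstruct.
From mathcomp Require Import ring lra zify fingroup perm.
From Stdlib Require Import ClassicalEpsilon.
From Stdlib Require Setoid Morphisms.
Set Implicit Arguments.
Unset Strict Implicit.
Unset Printing Implicit Defensive.
Import Order.TTheory GRing.Theory Num.Theory.
Local Open Scope ring_scope.

(** Under the asymptotic preorder the k-partite states form a preordered commutative monoid
    in which GHZ is an order unit: enough GHZ states are converted exactly into any given state.
    An achievable rate r yields rho^q (x) GHZ >= sigma^floor(rq) for every q, hence
    r E(sigma) <= E(rho) for all E in F_k.
    Conversely, the gauge p(a,b) = inf {s/n : b^n (x) GHZ^s >= a^n} is a sublinear functional
    of the formal difference a - b. If the rate u/v is not achievable, then
    p(sigma^u, rho^v) > 0, and a minimal sublinear functional below p with the same value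
    at (sigma^u, rho^v) is additive; normalised at GHZ it is an element E of F_k with
    E(rho)/E(sigma) <= u/v.
    Only convergence of the errors to 0 matters, so the purified distance can be exchanged
    for the trace distance by bounds that do not depend on the dimension. *)

(** * Commutative monoids up to equivalence *)

(** Local dimensions multiply under [tens], so associativity, commutativity and the unit law hold
    only after relabelling local bases. The abstract part therefore works in a monoid up to an
    equivalence [sim], and pairs [(a, b)] stand for formal differences without forming a quotient
    group. Cancellation of a common factor, which such differences require, comes from catalysis: a
    catalyst prepared once from GHZ copies can be reused arbitrarily often, so its cost per copy
    tends to 0. Errors enter through an index of [conv] that adds under composition and is unchanged
    by a spectator system. Trace distance has both properties by linearity and positivity alone. In
    the preparation of a state from GHZ copies the obstacle is coherence: a party that keeps a full
    record of the global basis index dephases the others. Its record has to be erased by a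
    measurement whose back-action is a phase, and this phase must factor over the parties to be
    undone locally. *)

Record cmonoid_upto (S : Type) (op : S -> S -> S) (one : S)
    (sim : S -> S -> Prop) : Prop := CMonoidUpto {
  sim_refl : forall x, sim x x;
  sim_sym : forall x y, sim x y -> sim y x;
  sim_trans : forall y x z, sim x y -> sim y z -> sim x z;
  sim_op : forall x x' y y', sim x x' -> sim y y' -> sim (op x y) (op x' y');
  simA : forall x y z, sim (op x (op y z)) (op (op x y) z);
  simC : forall x y, sim (op x y) (op y x);
  sim1 : forall x, sim (op one x) x }.

Inductive acterm := ACone | ACvar of nat | ACop of acterm & acterm.

Fixpoint acvars (t : acterm) : seq nat :=
  match t with ACone => [::] | ACvar i => [:: i] | ACop s t => acvars s ++ acvars t end.

Section ACNormalization.
Variables (S : Type) (op : S -> S -> S) (one : S) (sim : S -> S -> Prop).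
Hypothesis M : cmonoid_upto op one sim.

Fixpoint aceval (env : seq S) (t : acterm) : S :=
  match t with
  | ACone => one
  | ACvar i => nth one env i
  | ACop s t => op (aceval env s) (aceval env t)
  end.

Let prod (env : seq S) (s : seq nat) := foldr (fun i => op (nth one env i)) one s.

Lemma prod_cat env s t : sim (prod env (s ++ t)) (op (prod env s) (prod env t)).
Proof.
elim: s => [|i s IH] /=; first by apply: (sim_sym M); apply: (sim1 M).
apply: (sim_trans M); last exact: (simA M).
by apply: (sim_op M) => //; apply: (sim_refl M).
Qed.

Lemma aceval_prod env t : sim (aceval env t) (prod env (acvars t)).
Proof.
elim: t => [|i|s IHs t IHt] /=; first exact: (sim_refl M).
  by apply: (sim_trans M (y := op one (nth one env i)));
    [apply: (sim_sym M); apply: (sim1 M) | apply: (simC M)].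
apply: (sim_trans M); last by apply: (sim_sym M); apply: prod_cat.
exact: (sim_op M).
Qed.

Lemma prod_perm env s t : perm_eq s t -> sim (prod env s) (prod env t).
Proof.
elim: s t => [|i s IH] t.
  by rewrite perm_sym => /perm_nilP ->; apply: (sim_refl M).
move=> pst.
have : i \in t by rewrite -(perm_mem pst) mem_head.
move=> /path.splitPr tE; case: tE pst => t1 t2.
rewrite perm_sym -cat1s perm_catCA /= perm_cons perm_sym => /IH pst.
apply: (sim_trans M (y := op (nth one env i) (op (prod env t1) (prod env t2)))).
  apply: (sim_op M); first exact: (sim_refl M).
  exact: (sim_trans M pst (prod_cat _ _ _)).
apply: (sim_trans M); last by apply: (sim_sym M); exact: prod_cat.
rewrite /=.
apply: (sim_trans M (simA M _ _ _)); apply: (sim_trans M); last first.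
  by apply: (sim_sym M); exact: (simA M).
apply: (sim_op M); [exact: (simC M) | exact: (sim_refl M)].
Qed.

(** Reflection step behind [ac_sim]: for reified terms the permutation of variable lists is a closed
    computation, discharged there by [isT]. *)
Lemma aceval_sim env s t :
  perm_eq (acvars s) (acvars t) -> sim (aceval env s) (aceval env t).
Proof.
move=> pst; apply: (sim_trans M (aceval_prod _ _)).
apply: (sim_trans M); last by apply: (sim_sym M); apply: aceval_prod.
exact: prod_perm.
Qed.

End ACNormalization.

Ltac ac_index x env :=
  lazymatch env with
  | cons x _ => constr:(0%N)
  | cons _ ?e => let n := ac_index x e in constr:(S n)
  end.
Ltac ac_add x env :=
  lazymatch env with
  | context [cons x _] => env
  | _ => constr:(cons x env)
  end.
Ltac ac_env op one t env :=
  lazymatch t with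
  | one => env
  | op ?a ?b => let e := ac_env op one a env in ac_env op one b e
  | _ => ac_add t env
  end.
Ltac ac_reify op one t env :=
  lazymatch t with
  | one => constr:(ACone)
  | op ?a ?b => let s := ac_reify op one a env in
                let t := ac_reify op one b env in constr:(ACop s t)
  | _ => let n := ac_index t env in constr:(ACvar n)
  end.
Ltac ac_sim M :=
  lazymatch type of M with
  | @cmonoid_upto ?S ?op ?one ?sim =>
    lazymatch goal with
    | |- sim ?a ?b =>
      let e := ac_env op one a constr:(@nil S) in
      let e := ac_env op one b e in
      let s := ac_reify op one a e in
      let t := ac_reify op one b e in
      exact (@aceval_sim S op one sim M e s t isT)
    end
  end.

Section Powers.
Variables (S : Type) (op : S -> S -> S) (one : S) (sim : S -> S -> Prop).
Hypothesis M : cmonoid_upto op one sim.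

#[local] Instance sim_equivalence : RelationClasses.Equivalence sim.
Proof.
split; first exact: (sim_refl M).
  by move=> x y; apply: (sim_sym M).
by move=> x y z; apply: (sim_trans M).
Qed.

#[local] Instance op_proper : Morphisms.Proper (Morphisms.respectful sim (Morphisms.respectful sim sim)) op.
Proof. by move=> x x' xx' y y' yy'; apply: (sim_op M). Qed.

Definition pw (x : S) (n : nat) : S := iter n (op x) one.

Lemma pwD x m n : sim (pw x (m + n)) (op (pw x m) (pw x n)).
Proof.
elim: m => [|m IH]; first by rewrite add0n /=; ac_sim M.
by rewrite addSn /= IH; ac_sim M.
Qed.

Lemma pw1 x : sim (pw x 1) x.
Proof. by rewrite /=; ac_sim M. Qed.

Lemma pw_op x y n : sim (pw (op x y) n) (op (pw x n) (pw y n)).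
Proof. by elim: n => [|n IH] /=; [ac_sim M | rewrite IH; ac_sim M]. Qed.

Lemma pwM x m n : sim (pw x (m * n)) (pw (pw x m) n).
Proof.
elim: n => [|n IH]; first by rewrite muln0; reflexivity.
by rewrite mulnS pwD IH; reflexivity.
Qed.

End Powers.

(** * Additive monotone functionals on a preordered monoid *)

Lemma ge_inf_lb (R : realType) (E : set R) (c x : R) :
  (forall y, E y -> c <= y) -> E x -> inf E <= x.
Proof. by move=> cE Ex; apply: ge_inf => //; exists c => y; exact: cE. Qed.

(** Amortisation: a fixed overhead [c] spread over arbitrarily many copies disappears. It serves
    both for catalysts and for rounding of rates. *)
Lemma ler_archi (R : realType) (a b c : R) :
  (forall j : nat, (0 < j)%N -> a <= b + c / j%:R) -> a <= b.
Proof.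
move=> H; case: (lerP c 0) => c0.
  by have := H 1%N isT; rewrite divr1; lra.
apply/ler_addgt0Pr => e e0.
have ce : 0 <= c / e by rewrite divr_ge0 // ltW.
have j0 := archi_boundP ce; set j := Num.bound _ in j0.
have jp : 0 < j%:R :> R by apply: le_lt_trans j0.
apply: (le_trans (H j _)); first by rewrite -(ltr0n R).
by rewrite lerD2l ler_pdivrMr // mulrC -ler_pdivrMr // ltW.
Qed.

Section AdditiveFunctionals.
Variables (S : Type) (op : S -> S -> S) (one : S) (sim : S -> S -> Prop).
Hypothesis M : cmonoid_upto op one sim.
Variable ge : S -> S -> Prop.
Hypothesis ge_sim : forall x y, sim x y -> ge x y.
Hypothesis ge_trans : forall x y z, ge x y -> ge y z -> ge x z.
Hypothesis ge_op : forall x x' y y', ge x x' -> ge y y' -> ge (op x y) (op x' y').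
Hypothesis ge_one : forall x, ge x one.
Variable g : S.
Hypothesis ge_gen : forall y, exists m, ge (pw op one g m) y.
Variable R : realType.

#[local] Instance sim_equivalence' : RelationClasses.Equivalence sim := sim_equivalence M.
#[local] Instance op_proper' : Morphisms.Proper (Morphisms.respectful sim (Morphisms.respectful sim sim)) op := op_proper M.
#[local] Instance ge_preorder : RelationClasses.PreOrder ge.
Proof. by split; [move=> x; apply: ge_sim; reflexivity | exact: ge_trans]. Qed.
#[local] Instance ge_proper : Morphisms.Proper (Morphisms.respectful sim (Morphisms.respectful sim iff)) ge.
Proof.
move=> x x' xx' y y' yy'; split=> H.
  apply: (ge_trans (ge_sim (sim_sym M xx'))); exact: (ge_trans H (ge_sim yy')).
apply: (ge_trans (ge_sim xx')); exact: (ge_trans H (ge_sim (sim_sym M yy'))).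
Qed.

Local Notation "x ^^ n" := (pw op one x n) (at level 30).
Local Notation "x ⊗ y" := (op x y) (at level 40, left associativity).

Let ge_refl x : ge x x. Proof. reflexivity. Qed.

Lemma ge_pw x y n : ge x y -> ge (x ^^ n) (y ^^ n).
Proof. by move=> xy; elim: n => [|n IH] /=; [exact: ge_refl | exact: ge_op]. Qed.

Lemma ge_dropl x y : ge (x ⊗ y) y.
Proof.
apply: (ge_trans (ge_op (ge_one x) (ge_refl y))).
by apply: ge_sim; ac_sim M.
Qed.

Lemma ge_dropr x y : ge (x ⊗ y) x.
Proof. by rewrite (simC M); apply: ge_dropl. Qed.

Definition gauge_witness (a b : S) (n s : nat) :=
  (0 < n)%N /\ ge ((b ^^ n) ⊗ (g ^^ s)) (a ^^ n).

Definition gauge (a b : S) : R :=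
  inf [set r | exists n s, gauge_witness a b n s /\ r = s%:R / n%:R].

Lemma gauge_le a b n s : gauge_witness a b n s -> gauge a b <= s%:R / n%:R.
Proof.
move=> w; apply: (@ge_inf_lb _ _ 0).
  by move=> _ [n' [s' [_ ->]]]; apply: divr_ge0.
by exists n, s.
Qed.

Lemma le_gauge a b c :
  (forall n s, gauge_witness a b n s -> c <= s%:R / n%:R) -> c <= gauge a b.
Proof.
move=> H; apply: lb_le_inf.
  have [m gm] := ge_gen a.
  exists (m%:R / 1%:R), 1%N, m; split => //; split => //.
  rewrite (pw1 M) (pw1 M); exact: (ge_trans (ge_dropl _ _) gm).
by move=> _ [n [s [w ->]]]; exact: H.
Qed.

(** These are sublinear functionals of the formal difference $a-b$. Together with [subl_op] and
    [subl_diag], the field [subl_cancel] makes [q] invariant under a common factor, and [subl_pw]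
    upgrades subadditivity to homogeneity over the naturals. *)
Record sublinear (q : S -> S -> R) : Prop := Sublinear {
  subl_op : forall a b a' b', q (a ⊗ a') (b ⊗ b') <= q a b + q a' b';
  subl_pw : forall a b n, (0 < n)%N -> n%:R * q a b <= q (a ^^ n) (b ^^ n);
  subl_cancel : forall z a b, q a b <= q (z ⊗ a) (z ⊗ b);
  subl_ge : forall a b a' b', ge a' a -> ge b b' -> q a b <= q a' b';
  subl_one : 0 <= q one one;
  subl_diag : forall a, q a a <= 0 }.

Lemma gauge_sublinear : sublinear gauge.
Proof.
split.
- move=> a b a' b'.
  rewrite -lerBlDr; apply: le_gauge => n s [n0 w].
  rewrite lerBlDr -lerBlDl; apply: le_gauge => n' s' [n'0 w'].
  rewrite lerBlDl.
  have -> : s%:R / n%:R + s'%:R / n'%:R = (s * n' + s' * n)%:R / (n * n')%:R :> R.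
    have /eqP : n%:R != 0 :> R by rewrite pnatr_eq0 -lt0n.
    have /eqP : n'%:R != 0 :> R by rewrite pnatr_eq0 -lt0n.
    rewrite natrD !natrM => h1 h2; field; apply/andP; split; exact/eqP.
  apply: gauge_le; split; first by rewrite muln_gt0 n0.
  have := ge_op (ge_pw n' w) (ge_pw n w').
  rewrite !(pw_op M) -!(pwM M) !(pwD M) (mulnC n' n) => H.
  by apply: (ge_trans _ H); apply: ge_sim; ac_sim M.
- move=> a b n n0; apply: le_gauge => m s [m0 w].
  have : gauge_witness a b (n * m) s.
    by split; [rewrite muln_gt0 n0|rewrite !(pwM M)].
  move=> /gauge_le; rewrite natrM invfM mulrA mulrAC.
  by rewrite ler_pdivlMr ?ltr0n// mulrC.
(* Catalysis: [m * n] copies of [g] produce [z ^^ n], which then drives [j] conversions of [b ^^ n]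
   into [a ^^ n] and survives each of them. Its cost per copy is [m / j], removed by [ler_archi]. *)
- move=> z a b; apply: le_gauge => n s [n0]; rewrite !(pw_op M) => w.
  have [m gm] := ge_gen z.
  apply: (@ler_archi _ _ _ m%:R) => j j0.
  have -> : s%:R / n%:R + m%:R / j%:R = (m * n + s * j)%:R / (n * j)%:R :> R.
    have /eqP : n%:R != 0 :> R by rewrite pnatr_eq0 -lt0n.
    have /eqP : j%:R != 0 :> R by rewrite pnatr_eq0 -lt0n.
    rewrite natrD !natrM => h1 h2; field; apply/andP; split; exact/eqP.
  apply: gauge_le; split; first by rewrite muln_gt0 n0.
  rewrite !(pwD M) !(pwM M).
  have H : ge ((z ^^ n) ⊗ (b ^^ n ^^ j) ⊗ (g ^^ s ^^ j)) ((z ^^ n) ⊗ (a ^^ n ^^ j)).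
    elim: (j) => [|i IH] /=; first exact: ge_dropr.
    have H1 := ge_op IH (ge_refl ((b ^^ n) ⊗ (g ^^ s))).
    have H2 := ge_op w (ge_refl (a ^^ n ^^ i)).
    apply: (ge_trans (y := (z ^^ n) ⊗ (b ^^ n ^^ i) ⊗ (g ^^ s ^^ i) ⊗
      ((b ^^ n) ⊗ (g ^^ s)))); first by apply: ge_sim; ac_sim M.
    apply: (ge_trans H1).
    apply: (ge_trans (y := (z ^^ n) ⊗ (b ^^ n) ⊗ (g ^^ s) ⊗ (a ^^ n ^^ i))).
      by apply: ge_sim; ac_sim M.
    by apply: (ge_trans H2); apply: ge_sim; ac_sim M.
  have gz := ge_pw n gm.
  apply: (ge_trans _ (ge_trans H (ge_dropl _ _))).
  apply: (ge_trans (ge_op (ge_refl _) (ge_op gz (ge_refl _)))).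
  by apply: ge_sim; ac_sim M.
- move=> a b a' b' aa' bb'; apply: le_gauge => n s [n0 w].
  apply: gauge_le; split => //.
  apply: (ge_trans (ge_op (ge_pw n bb') (ge_refl _))).
  exact: (ge_trans w (ge_pw n aa')).
- by apply: le_gauge => n s _; apply: divr_ge0.
- move=> a; suff : gauge a a <= 0%:R / 1%:R by rewrite mul0r.
  by apply: gauge_le; split => //; exact: ge_dropr.
Qed.

Lemma subl_sim q a b a' b' : sublinear q -> sim a a' -> sim b b' -> q a b = q a' b'.
Proof.
move=> sq aa' bb'; apply/eqP; rewrite eq_le; apply/andP; split.
  by apply: subl_ge => //; apply: ge_sim => //; apply: (sim_sym M).
by apply: subl_ge => //; apply: ge_sim => //; apply: (sim_sym M).
Qed.

Lemma subl_pw0 q a b n : sublinear q -> n%:R * q a b <= q (a ^^ n) (b ^^ n).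
Proof.
move=> sq; case: n => [|n]; first by rewrite mul0r; apply: subl_one.
exact: subl_pw.
Qed.

Lemma subl_pwE q a b n : sublinear q -> q (a ^^ n) (b ^^ n) = n%:R * q a b.
Proof.
move=> sq; apply/eqP; rewrite eq_le subl_pw0 // andbT.
elim: n => [|n IH] /=; first by rewrite mul0r; apply: subl_diag.
by apply: le_trans (subl_op sq _ _ _ _) _; rewrite mulrSr mulrDl mul1r addrC lerD2r.
Qed.

(** Subadditivity for $c-d=((c+a)-(d+b))+(b-a)$, after cancelling the common factor [a ⊗ b]. *)
Lemma subl_swap q a b c d : sublinear q ->
  q c d <= q (c ⊗ a) (d ⊗ b) + q b a.
Proof.
move=> sq; apply: le_trans (subl_op sq _ _ _ _).
apply: le_trans (subl_cancel sq (a ⊗ b) _ _) _.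
by rewrite (subl_sim (a' := c ⊗ a ⊗ b) (b' := d ⊗ b ⊗ a) sq) //; ac_sim M.
Qed.

(** The auxiliary functional from the minimal-element proof of the Hahn-Banach theorem: with $w=a-b$
    and $h=u-v$ it is $\inf_m\,q(w+mh)-m\,q(h)$. It stays sublinear and below [q], and forces the
    value at $-h$ down to at most $-q(h)$. *)
Definition lowered (q : S -> S -> R) (u v a b : S) : R :=
  inf [set r | exists m, r = q (a ⊗ (u ^^ m)) (b ⊗ (v ^^ m)) - m%:R * q u v].

Section Lowered.
Variables (q : S -> S -> R) (u v : S).
Hypothesis sq : sublinear q.

(** A lower bound independent of [m], without which [inf] would carry no information. *)
Let step a b m : - q b a <= q (a ⊗ (u ^^ m)) (b ⊗ (v ^^ m)) - m%:R * q u v.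
Proof.
have := subl_swap a b (u ^^ m) (v ^^ m) sq.
rewrite (subl_sim (a := (u ^^ m) ⊗ a) (b := (v ^^ m) ⊗ b)
  (a' := a ⊗ (u ^^ m)) (b' := b ⊗ (v ^^ m)) sq); try by ac_sim M.
have := subl_pw0 u v m sq; lra.
Qed.

Let lowered_le_m a b m : lowered q u v a b <= q (a ⊗ (u ^^ m)) (b ⊗ (v ^^ m)) - m%:R * q u v.
Proof.
apply: (@ge_inf_lb _ _ (- q b a)); last by exists m.
by move=> _ [m' ->]; exact: step.
Qed.

Let le_lowered a b c :
  (forall m, c <= q (a ⊗ (u ^^ m)) (b ⊗ (v ^^ m)) - m%:R * q u v) -> c <= lowered q u v a b.
Proof.
move=> H; apply: lb_le_inf; last by move=> _ [m ->].
by exists (q (a ⊗ (u ^^ 0)) (b ⊗ (v ^^ 0)) - 0%:R * q u v), 0%N.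
Qed.

Lemma lowered_le a b : lowered q u v a b <= q a b.
Proof.
apply: le_trans (lowered_le_m a b 0) _; rewrite mul0r subr0 /=.
by rewrite (subl_sim (a' := a) (b' := b) sq) //; ac_sim M.
Qed.

Lemma lowered_opp : lowered q u v v u <= - q u v.
Proof.
apply: le_trans (lowered_le_m v u 1) _; rewrite mul1r gerDr.
apply: le_trans (subl_diag sq (u ⊗ v)).
by rewrite (subl_sim (a' := u ⊗ v) (b' := u ⊗ v) sq) //=; ac_sim M.
Qed.

(** The terms are nonincreasing in [m]. In the proof of homogeneity this allows passing from [m] to
    [n * m], where the term for the [n]-th powers is exactly [n] times the term at [m] for [a] and
    [b]. *)
Let desc a b m j : q (a ⊗ (u ^^ (m + j))) (b ⊗ (v ^^ (m + j))) - (m + j)%:R * q u v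
  <= q (a ⊗ (u ^^ m)) (b ⊗ (v ^^ m)) - m%:R * q u v.
Proof.
have := subl_op sq (a ⊗ (u ^^ m)) (b ⊗ (v ^^ m)) (u ^^ j) (v ^^ j).
rewrite (subl_pwE _ _ _ sq).
rewrite (subl_sim (a' := a ⊗ (u ^^ (m + j))) (b' := b ⊗ (v ^^ (m + j))) sq).
- rewrite natrD; lra.
- by rewrite (pwD M); ac_sim M.
- by rewrite (pwD M); ac_sim M.
Qed.

Lemma lowered_sublinear : sublinear (lowered q u v).
Proof.
split.
- move=> a b a' b'.
  rewrite -lerBlDr; apply: le_lowered => m.
  rewrite lerBlDr -lerBlDl; apply: le_lowered => m'.
  rewrite lerBlDl; apply: le_trans (lowered_le_m _ _ (m + m')) _.
  have := subl_op sq (a ⊗ (u ^^ m)) (b ⊗ (v ^^ m)) (a' ⊗ (u ^^ m')) (b' ⊗ (v ^^ m')).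
  rewrite (subl_sim (a' := a ⊗ a' ⊗ (u ^^ (m + m')))
    (b' := b ⊗ b' ⊗ (v ^^ (m + m'))) sq).
  + rewrite natrD; lra.
  + by rewrite (pwD M); ac_sim M.
  + by rewrite (pwD M); ac_sim M.
- move=> a b n n0; apply: le_lowered => m.
  have mE : (m + (n * m - m) = n * m)%N by rewrite subnKC // leq_pmull.
  apply: le_trans (desc _ _ _ (n * m - m)); rewrite mE.
  rewrite (subl_sim (a' := (a ⊗ (u ^^ m)) ^^ n) (b' := (b ⊗ (v ^^ m)) ^^ n) sq).
  + rewrite (subl_pwE _ _ _ sq) natrM -mulrA -mulrBr ler_pM2l ?ltr0n //.
  + by rewrite (pw_op M) -(pwM M) mulnC; reflexivity.
  + by rewrite (pw_op M) -(pwM M) mulnC; reflexivity.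
- move=> z a b; apply: le_lowered => m.
  apply: le_trans (lowered_le_m _ _ m) _; rewrite lerD2r.
  apply: le_trans (subl_cancel sq z _ _) _.
  by rewrite (subl_sim (a' := z ⊗ a ⊗ (u ^^ m)) (b' := z ⊗ b ⊗ (v ^^ m)) sq) //;
    ac_sim M.
- move=> a b a' b' aa' bb'; apply: le_lowered => m.
  apply: le_trans (lowered_le_m _ _ m) _; rewrite lerD2r.
  by apply: subl_ge => //; apply: ge_op.
- apply: le_lowered => m.
  rewrite (subl_sim (a' := u ^^ m) (b' := v ^^ m) sq); try by ac_sim M.
  by rewrite (subl_pwE _ _ _ sq) subrr.
- by move=> a; apply: le_trans (lowered_le _ _) (subl_diag sq a).
Qed.

End Lowered.

(** From $0\le q(0)\le q(a-b)+q(b-a)$. It keeps the pointwise infimum over a chain finite in the use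
    of Zorn's lemma. *)
Lemma subl_opp q a b : sublinear q -> - q b a <= q a b.
Proof.
move=> sq; have := subl_swap a b one one sq.
rewrite (subl_sim (a := one ⊗ a) (b := one ⊗ b) (a' := a) (b' := b) sq); try by ac_sim M.
have := subl_one sq; lra.
Qed.

Lemma minimal_sublinear (p : S -> S -> R) : sublinear p ->
  exists q, [/\ sublinear q, (forall a b, q a b <= p a b) &
    forall q', sublinear q' -> (forall a b, q' a b <= q a b) -> q' = q].
Proof.
move=> sp.
pose T := {q : S -> S -> R | sublinear q /\ forall a b, q a b <= p a b}.
have sT (f : T) : sublinear (sval f) by case: (svalP f).
(* The order is reversed, so that the maximal element given by [Zorn] is a minimal functional. *)
pose r (q q' : T) : bool := `[< forall a b, sval q' a b <= sval q a b >].
have [||||[q [sq qp]] qmin] := @Zorn T r.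
- by move=> q; apply/asboolP => a b.
- move=> q1 q2 q3 /asboolP h1 /asboolP h2; apply/asboolP => a b.
  exact: le_trans (h2 a b) (h1 a b).
- move=> [q1 h1] [q2 h2] /asboolP /= h3 /asboolP /= h4.
  suff E : q1 = q2 by subst q2; congr exist; exact: Prop_irrelevance.
  by apply: funext => a; apply: funext => b; apply/eqP; rewrite eq_le h3 h4.
- move=> A totA.
  have [A0|/existsNP[f0 /contrapT Af0]] := pselect (forall f, ~ A f).
    by exists (exist _ p (conj sp (fun a b => lexx _))) => s /A0.
  pose q a b := inf [set x | exists f : T, A f /\ x = sval f a b].
  have q_le f a b : A f -> q a b <= sval f a b.
    move=> Af; apply: (@ge_inf_lb _ _ (- p b a)); last by exists f.
    move=> _ [[h [sh hp]] [_ ->]] /=; apply: le_trans (subl_opp a b sh).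
    by rewrite lerN2.
  have q_ge a b c : (forall f, A f -> c <= sval f a b) -> c <= q a b.
    move=> H; apply: lb_le_inf; first by exists (sval f0 a b), f0.
    by move=> _ [f [Af ->]]; exact: H.
  have sq : sublinear q.
    split.
    + move=> a b a' b'.
      rewrite -lerBlDr; apply: (q_ge) => f Af.
      rewrite lerBlDr -lerBlDl; apply: q_ge => f' Af'.
      rewrite lerBlDl.
      (* Two different members of the chain approximate the two infima; by totality the smaller one
         serves for both. *)
      case: (totA _ _ Af Af') => /asboolP ff'.
        apply: le_trans (q_le _ _ _ Af') _.
        have := subl_op (sT f') a b a' b'; have := ff' a b; lra.
      apply: le_trans (q_le _ _ _ Af) _.
      have := subl_op (sT f) a b a' b'; have := ff' a' b'; lra.
    + move=> a b n n0; apply: q_ge => f Af.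
      apply: le_trans (subl_pw (sT f) _ _ n0).
      by rewrite ler_pM2l ?ltr0n // q_le.
    + move=> z a b; apply: q_ge => f Af; apply: le_trans (q_le _ _ _ Af) _.
      exact: subl_cancel (sT f) _ _ _.
    + move=> a b a' b' h h'; apply: q_ge => f Af; apply: le_trans (q_le _ _ _ Af) _.
      exact: subl_ge (sT f) _ _ _ _ h h'.
    + apply: q_ge => f Af; exact: subl_one (sT f).
    + move=> a; apply: le_trans (q_le _ _ _ Af0) _.
      exact: subl_diag (sT f0) _.
  have qp : forall a b, q a b <= p a b.
    by move=> a b; apply: le_trans (q_le _ _ _ Af0) _; apply: (proj2 (svalP f0)).
  exists (exist _ q (conj sq qp)) => f Af; apply/asboolP => a b /=.
  exact: q_le.
exists q; split => // q' sq' q'q.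
have q'p : forall a b, q' a b <= p a b by move=> a b; apply: le_trans (q'q a b) (qp a b).
have := qmin (exist _ q' (conj sq' q'p)); rewrite /r /= => H.
by have /(congr1 sval) := H (asboolT q'q).
Qed.

(* Lowering the gauge at (x, y) before minimising forces equality at (x, y); a minimal
   sublinear functional coincides with all its lowerings, hence is additive. *)
Theorem additive_functional (x y : S) : exists E : S -> R,
  [/\ forall a b, E (a ⊗ b) = E a + E b,
      forall a b, ge a b -> E b <= E a,
      E g <= 1 & gauge x y <= E x - E y].
Proof.
have sg := gauge_sublinear.
have [q [sq qp qmin]] := minimal_sublinear (lowered_sublinear x y sg).
have qN a b : q b a <= - q a b.
  rewrite -{1}(qmin _ (lowered_sublinear a b sq) (lowered_le a b sq)).
  exact: lowered_opp.
have qD a b a' b' : q (a ⊗ a') (b ⊗ b') = q a b + q a' b'.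
  apply/eqP; rewrite eq_le subl_op //=.
  have := subl_swap a' b' a b sq.
  by have := qN a' b'; lra.
exists (fun a => q a one); split.
- move=> a b; rewrite -qD; apply: subl_sim => //; last by ac_sim M.
  reflexivity.
- by move=> a b ab; apply: subl_ge.
- apply: le_trans (qp _ _) _; apply: le_trans (lowered_le _ _ sg _ _) _.
  have -> : 1 = 1%:R / 1%:R :> R by rewrite divr1.
  by apply: gauge_le; split => //; rewrite !(pw1 M); apply: ge_dropl.
have : gauge x y <= q x y.
  have := qN y x; have := qp y x; have := lowered_opp x y sg; have := qN x y.
  by have := subl_opp x y sq; lra.
have <- : q (x ⊗ one) (one ⊗ y) = q x y.
  by apply: subl_sim => //; ac_sim M.
rewrite qD; have := qN y one; lra.
Qed.

End AdditiveFunctionals.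

(** * Rates *)

Section Rates.
Variables (S : Type) (op : S -> S -> S) (one : S) (sim : S -> S -> Prop).
Hypothesis M : cmonoid_upto op one sim.
Variables (R : realType) (conv : R -> S -> S -> Prop) (g : S).
Hypothesis conv_sim : forall x y, sim x y -> conv 0 x y.
Hypothesis conv_trans : forall s t x y z, conv s x y -> conv t y z -> conv (s + t) x z.
Hypothesis conv_opr : forall t x y z, conv t x y -> conv t (op x z) (op y z).
Hypothesis conv_le : forall s t x y, s <= t -> conv s x y -> conv t x y.
Hypothesis conv_drop : forall x y, conv 0 (op x y) x.
Hypothesis conv_gen : forall y, exists m, conv 0 (pw op one g m) y.

#[local] Instance sim_equivalence'' : RelationClasses.Equivalence sim := sim_equivalence M.
#[local] Instance op_proper'' : Morphisms.Proper (Morphisms.respectful sim (Morphisms.respectful sim sim)) op := op_proper M.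
#[local] Instance conv_proper t : Morphisms.Proper (Morphisms.respectful sim (Morphisms.respectful sim iff)) (conv t).
Proof.
move=> x x' xx' y y' yy'; split=> H; rewrite -[t]add0r -[t]addr0 addrA.
  apply: conv_trans (conv_sim yy').
  exact: (conv_trans (conv_sim (sim_sym M xx')) H).
apply: conv_trans (conv_sim (sim_sym M yy')).
exact: (conv_trans (conv_sim xx') H).
Qed.

Local Notation "x ^^ n" := (pw op one x n) (at level 30).
Local Notation "x ⊗ y" := (op x y) (at level 40, left associativity).

Let conv_refl x : conv 0 x x. Proof. by apply: conv_sim; reflexivity. Qed.

Lemma conv0l t x y z : conv 0 x y -> conv t y z -> conv t x z.
Proof. by move=> h1 h2; rewrite -[t]add0r; apply: conv_trans h1 h2. Qed.

Lemma conv0r t x y z : conv t x y -> conv 0 y z -> conv t x z.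
Proof. by move=> h1 h2; rewrite -[t]addr0; apply: conv_trans h1 h2. Qed.

Lemma conv_op s t x x' y y' :
  conv s x x' -> conv t y y' -> conv (s + t) (x ⊗ y) (x' ⊗ y').
Proof.
move=> h1 h2; apply: conv_trans (conv_opr y h1) _.
by rewrite (simC M x' y) (simC M x' y'); apply: conv_opr.
Qed.

Lemma conv0_pw x y n : conv 0 x y -> conv 0 (x ^^ n) (y ^^ n).
Proof.
move=> xy; elim: n => [|n IH] /=; first exact: conv_refl.
by rewrite -[0]addr0; apply: conv_op.
Qed.

Lemma conv0_pw_le x m n : (n <= m)%N -> conv 0 (x ^^ m) (x ^^ n).
Proof. by move=> nm; rewrite -(subnKC nm) (pwD M); apply: conv_drop. Qed.

Definition asg (x y : S) : Prop :=
  forall eps : R, 0 < eps -> exists N, forall n, (N <= n)%N -> conv eps (x ^^ n) (y ^^ n).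

Lemma asg_conv0 x y : conv 0 x y -> asg x y.
Proof.
move=> xy e e0; exists 0%N => n _; apply: conv_le (ltW e0) _; exact: conv0_pw.
Qed.

Lemma asg_trans x y z : asg x y -> asg y z -> asg x z.
Proof.
move=> xy yz e e0; have e2 : 0 < e / 2 by rewrite divr_gt0.
have [N1 h1] := xy _ e2; have [N2 h2] := yz _ e2.
exists (maxn N1 N2) => n; rewrite geq_max => /andP[n1 n2].
have -> : e = e / 2 + e / 2 by lra.
exact: conv_trans (h1 _ n1) (h2 _ n2).
Qed.

Lemma asg_op x x' y y' : asg x x' -> asg y y' -> asg (x ⊗ y) (x' ⊗ y').
Proof.
move=> xx' yy' e e0; have e2 : 0 < e / 2 by rewrite divr_gt0.
have [N1 h1] := xx' _ e2; have [N2 h2] := yy' _ e2.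
exists (maxn N1 N2) => n; rewrite geq_max => /andP[n1 n2].
have -> : e = e / 2 + e / 2 by lra.
rewrite !(pw_op M); exact: conv_op (h1 _ n1) (h2 _ n2).
Qed.

Lemma asg_one x : asg x one.
Proof.
apply: asg_conv0; apply: (conv0l (y := one ⊗ x)); last exact: conv_drop.
by apply: conv_sim; ac_sim M.
Qed.

Definition rate_achievable (x y : S) (r : R) : Prop :=
  0 <= r /\ forall delta : R, 0 < delta -> forall eps : R, 0 < eps ->
  exists N, forall n, (N <= n)%N ->
    conv eps ((x ^^ n) ⊗ (g ^^ (Num.truncn (delta * n%:R)))) (y ^^ `|Num.ceil (r * n%:R)|%N).

Definition entanglement_measure (E : S -> R) : Prop :=
  [/\ E g = 1, forall a b, E (a ⊗ b) = E a + E b & forall a b, asg a b -> E b <= E a].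

Lemma abs_ceil_le (r : R) m : 0 <= r -> r <= m%:R -> (`|Num.ceil r|%N <= m)%N.
Proof.
move=> r0 rm; have c0 : (0 <= Num.ceil r)%R by rewrite ceil_ge0; apply: lt_le_trans r0; rewrite ltrN10.
have : (Num.ceil r <= m%:Z)%R by rewrite ceil_le_int.
by move: c0; case: (Num.ceil r) => // n _; rewrite lez_nat.
Qed.

Lemma abs_ceil_ge (r : R) m : 0 <= r -> m%:R <= r -> (m <= `|Num.ceil r|%N)%N.
Proof.
move=> r0 rm; have c0 : (0 <= Num.ceil r)%R by rewrite ceil_ge0; apply: lt_le_trans r0; rewrite ltrN10.
rewrite -(ler_nat R); apply: (le_trans rm).
have := ceil_ge r.
by move: c0; case: (Num.ceil r) => // n _; rewrite absz_nat.
Qed.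

Lemma measure_pw E x n : entanglement_measure E -> E (x ^^ n) = n%:R * E x.
Proof.
case=> _ ED Em; elim: n => [|n IH] /=.
  rewrite mul0r; have := ED one one.
  suff -> : E (one ⊗ one) = E one by move=> h; lra.
  by apply/eqP; rewrite eq_le; apply/andP; split; apply: Em; apply: asg_conv0;
    apply: conv_sim; ac_sim M.
by rewrite ED IH -natr1 mulrDl mul1r addrC.
Qed.

Lemma measure_ge0 E x : entanglement_measure E -> 0 <= E x.
Proof.
move=> mE; have <- : E (x ^^ 0) = 0 by rewrite (measure_pw _ _ mE) mul0r.
by case: mE => _ _; apply; apply: asg_one.
Qed.

Lemma rate_le_measure E x y r :
  rate_achievable x y r -> entanglement_measure E -> r * E y <= E x.
Proof.
move=> [r0 ach] mE; have [Eg ED Em] := mE.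
(* The overhead to be divided by [q]: the summand 1 is the value of one copy of [g], and [E y]
   covers rounding [r * q] down to [p]. *)
apply: (@ler_archi _ _ _ (1 + E y)) => q q0.
have q0' : 0 < q%:R :> R by rewrite ltr0n.
set p := Num.truncn (r * q%:R).
have rq0 : 0 <= r * q%:R by rewrite mulr_ge0 // ler0n.
have pr : p%:R <= r * q%:R by rewrite /p truncn_le.
have : E (y ^^ p) <= E ((x ^^ q) ⊗ g).
  (* With $\delta=1/q$ and $n=qm$ exactly $m$ copies of [g] are granted, one for each copy of
     [(x ^^ q) ⊗ g]. *)
  apply: Em => e e0; have dq : 0 < q%:R^-1 :> R by rewrite invr_gt0.
  have [N HN] := ach _ dq _ e0; exists N => m Nm.
  have := HN (q * m)%N (leq_trans Nm (leq_pmull _ q0)).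
  have -> : Num.truncn (q%:R^-1 * (q * m)%:R : R) = m.
    by rewrite natrM mulrA mulVf ?gt_eqF // mul1r natrK.
  move=> H; rewrite (pw_op M) -!(pwM M).
  apply: (conv0r H); apply: conv0_pw_le; apply: abs_ceil_ge.
    by rewrite mulr_ge0 ?ler0n.
  by rewrite !natrM mulrA ler_wpM2r ?ler0n.
rewrite ED Eg !(measure_pw _ _ mE) => h.
have hp : r * q%:R < p%:R + 1 by rewrite natr1 truncnS_gt.
have Ey := measure_ge0 y mE.
have h2 : r * q%:R * E y <= (p%:R + 1) * E y by rewrite ler_wpM2r // ltW.
rewrite -(ler_pM2r q0') mulrDl divfK ?gt_eqF //; nra.
Qed.

(** Cut [m] copies into [j] blocks of length [n], each yielding [y ^^ t]. The incomplete block is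
    made up for by one further [y ^^ t], prepared from [K] copies of [g]. The blocks and this
    preparation each spend at most [delta * m] copies of [g], whence the factor 2. The error is paid
    once, because [asg] bounds the error of the whole [j]-fold power. *)
Lemma rate_of_asg x y n s t (r delta : R) : (0 < n)%N -> 0 <= r -> 0 < delta ->
  asg ((x ^^ n) ⊗ (g ^^ s)) (y ^^ t) -> s%:R <= delta * n%:R -> r * n%:R <= t%:R ->
  forall eps : R, 0 < eps -> exists N, forall m, (N <= m)%N ->
    conv eps ((x ^^ m) ⊗ (g ^^ (Num.truncn (2 * delta * m%:R)))) (y ^^ `|Num.ceil (r * m%:R)|%N).
Proof.
move=> n0 r0 d0 Has sd rt e e0.
have [N0 HN] := Has _ e0; have [K HK] := conv_gen (y ^^ t).
have Kd0 : 0 <= K%:R / delta by rewrite divr_ge0 // ltW.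
have hK := archi_boundP Kd0; set K' := Num.bound _ in hK.
(* The first bound gives at least [N0] complete blocks, the second makes the fixed cost [K] at most
   [delta * m]. *)
exists (maxn (n * N0) K') => m; rewrite geq_max => /andP[mN mK].
set j := (m %/ n)%N; have mE := divn_eq m n; have mlt := ltn_pmod m n0.
have jm : (n * j <= m)%N by rewrite mulnC leq_trunc_div.
have mj : (m <= n * j.+1)%N by rewrite mulnC; apply: ltnW; rewrite ltn_ceil.
have Nj : (N0 <= j)%N by rewrite leq_divRL // mulnC.
have le1 : (s * j + K <= Num.truncn (2 * delta * m%:R))%N.
  rewrite truncn_ge_nat; last by rewrite !mulr_ge0 ?ler0n // ltW.
  have h1 : s%:R * j%:R <= delta * m%:R.
    apply: (le_trans (y := delta * n%:R * j%:R)); first by rewrite ler_wpM2r.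
    by rewrite -mulrA (ler_wpM2l (ltW d0)) // -natrM ler_nat.
  have h2 : K%:R <= delta * m%:R.
    rewrite mulrC -ler_pdivrMr //; apply: le_trans (ltW hK) _.
    by rewrite ler_nat.
  rewrite natrD natrM; lra.
have le2 : (`|Num.ceil (r * m%:R)|%N <= t * j + t)%N.
  apply: abs_ceil_le; first by rewrite mulr_ge0 ?ler0n.
  rewrite -mulnSr natrM; apply: (le_trans (y := r * n%:R * j.+1%:R)).
    by rewrite -mulrA ler_wpM2l // -natrM ler_nat.
  by rewrite ler_wpM2r.
apply: (conv0r _ (conv0_pw_le _ le2)).
apply: (conv0l (y := (x ^^ (n * j)) ⊗ (g ^^ (s * j + K)))).
  by rewrite -[0]addr0; apply: conv_op; apply: conv0_pw_le.
rewrite !(pwD M) !(pwM M).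
apply: (conv0r (y := ((y ^^ t) ^^ j) ⊗ (y ^^ t))); last exact: conv_refl.
rewrite -[e]addr0 (simA M) -(pw_op M); apply: conv_op => //; exact: HN.
Qed.

Lemma measure_of_unachievable x y r u v : 0 <= r -> ~ rate_achievable x y r ->
  (0 < v)%N -> r * v%:R <= u%:R ->
  exists E, [/\ entanglement_measure E, E y != 0 & E x / E y <= u%:R / v%:R].
Proof.
move=> r0 nach v0 rvu.
have v0' : 0 < v%:R :> R by rewrite ltr0n.
(* Failure of the rate leaves a uniform positive cost [d] in copies of [g] per copy of [x].
   Otherwise [rate_of_asg], applied with [delta / 2] to absorb its factor 2, would establish
   achievability. *)
have [d d0 Hd] : exists2 d : R, 0 < d & forall n s t, (0 < n)%N ->
    asg ((x ^^ n) ⊗ (g ^^ s)) (y ^^ t) -> r * n%:R <= t%:R -> d * n%:R <= s%:R.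
  apply: contrapT => H; apply: nach; split => // delta d0 eps e0.
  apply: contrapT => H'; apply: H; exists (delta / 2); first by rewrite divr_gt0.
  move=> n s t n0 H1 H2; rewrite leNgt; apply/negP => /ltW H3; apply: H'.
  have d2 : 0 < delta / 2 by rewrite divr_gt0.
  have -> : delta = 2 * (delta / 2) by lra.
  exact: (rate_of_asg n0 r0 d2 H1 H3 H2 e0).
have asg_sim a b : sim a b -> asg a b by move=> /conv_sim/asg_conv0.
have ge_gen z : exists m, asg (g ^^ m) z.
  by have [m hm] := conv_gen z; exists m; apply: asg_conv0.
have [E [ED Em Eg HE]] :=
  additive_functional M asg_sim asg_trans asg_op asg_one ge_gen R (y ^^ u) (x ^^ v).
have Hg : d <= gauge op one asg g R (y ^^ u) (x ^^ v).
  apply: (le_gauge M asg_sim asg_trans asg_op asg_one ge_gen) => n s [n0 w].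
  rewrite ler_pdivlMr ?ltr0n //; apply: le_trans (Hd (v * n)%N s (u * n)%N _ _ _).
  - by rewrite (ler_wpM2l (ltW d0)) // ler_nat leq_pmull.
  - by rewrite muln_gt0 v0.
  - apply: asg_trans (asg_trans w _).
      by apply: asg_sim; rewrite (pwM M); reflexivity.
    by apply: asg_sim; rewrite (pwM M); reflexivity.
  - by rewrite !natrM mulrA ler_wpM2r.
have E1 : E one = 0.
  have := ED one one; suff -> : E (one ⊗ one) = E one by move=> h; lra.
  by apply/eqP; rewrite eq_le; apply/andP; split; apply: Em; apply: asg_sim; ac_sim M.
have Epw a n : E (a ^^ n) = n%:R * E a.
  elim: n => [|n IH] /=; first by rewrite mul0r.
  by rewrite ED IH -natr1 mulrDl mul1r addrC.
have E0 a : 0 <= E a by rewrite -E1; apply: Em; apply: asg_one.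
rewrite !Epw in HE.
have hyx : v%:R * E x < u%:R * E y by move: (lt_le_trans d0 Hg); lra.
have Ey : 0 < E y.
  rewrite lt_neqAle E0 andbT; apply/eqP => Ey; move: hyx; rewrite -Ey mulr0.
  by rewrite ltNge mulr_ge0 // ?ler0n // E0.
(* So far [E g] is only bounded above by 1. If it vanished, so would [E y], since copies of [g]
   dominate [y]; hence [E] can be normalised at [g]. *)
have Eg0 : 0 < E g.
  rewrite lt_neqAle E0 andbT; apply/eqP => Eg'.
  have [m hm] := ge_gen y; have := Em _ _ hm; rewrite Epw -Eg' mulr0.
  by rewrite leNgt Ey.
exists (fun a => E a / E g); split.
- split; first by rewrite divff ?gt_eqF.
    by move=> a b; rewrite ED mulrDl.
  by move=> a b ab; rewrite ler_pM2r ?invr_gt0 // Em.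
- by rewrite gt_eqF // divr_gt0.
rewrite -mulf_div divff ?mulr1; last by rewrite invr_eq0 gt_eqF.
by rewrite ler_pdivrMr // mulrAC ler_pdivlMr // mulrC ltW.
Qed.

End Rates.

(** * Fidelity and trace distance *)

Section PsdMatrices.
Local Open Scope sesquilinear_scope.
Variable K : numClosedFieldType.

Lemma dagM m n p (A : 'M[K]_(m, n)) (B : 'M[K]_(n, p)) : (A *m B)^t* = B^t* *m A^t*.
Proof. by rewrite trmx_mul map_mxM. Qed.

Lemma dagD m n (A B : 'M[K]_(m, n)) : (A + B)^t* = A^t* + B^t*.
Proof. by rewrite linearD /= map_mxD. Qed.

Lemma dagB m n (A B : 'M[K]_(m, n)) : (A - B)^t* = A^t* - B^t*.
Proof. by rewrite linearB /= map_mxB. Qed.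

Lemma dagZ m n (a : K) (A : 'M[K]_(m, n)) : (a *: A)^t* = a^* *: A^t*.
Proof. by rewrite linearZ /= map_mxZ. Qed.

Lemma dag_diag n (D : 'rV[K]_n) : (forall i, D 0 i \is Num.real) ->
  (diag_mx D)^t* = diag_mx D.
Proof.
move=> Dr; apply/matrixP => i j; rewrite !mxE eq_sym.
by case: eqP => [->|_]; rewrite ?mulr1n ?mulr0n ?rmorph0 // (CrealP (Dr _)).
Qed.

Definition psdmx n (A : 'M[K]_n) : Prop :=
  forall v : 'cV[K]_n, 0 <= (v^t* *m A *m v) 0 0.

Lemma psdmx_gram m n (X : 'M[K]_(m, n)) : psdmx (X *m X^t*).
Proof.
move=> v; rewrite mulmxA -mulmxA.
have -> : X^t* *m v = (v^t* *m X)^t* by rewrite dagM trmxCK.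
by rewrite mxE sumr_ge0 // => i _; rewrite !mxE mul_conjC_ge0.
Qed.

Lemma psdmx_congr m n (A : 'M[K]_n) (X : 'M[K]_(m, n)) :
  psdmx A -> psdmx (X *m A *m X^t*).
Proof. by move=> pA v; have := pA (X^t* *m v); rewrite dagM trmxCK !mulmxA. Qed.

Lemma psdmxD n (A B : 'M[K]_n) : psdmx A -> psdmx B -> psdmx (A + B).
Proof. by move=> pA pB v; rewrite mulmxDr mulmxDl mxE addr_ge0 ?pA ?pB. Qed.

Lemma psdmxZ n a (A : 'M[K]_n) : 0 <= a -> psdmx A -> psdmx (a *: A).
Proof.
by move=> a0 pA v; rewrite -scalemxAr -scalemxAl mxE mulr_ge0 ?pA.
Qed.

Lemma psdmx_diag_ge0 n (A : 'M[K]_n) i : psdmx A -> 0 <= A i i.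
Proof.
move=> /(_ (delta_mx i 0)); congr (0 <= _).
rewrite mxE (bigD1 i) //= big1 ?addr0; last first.
  by move=> j ji; rewrite [delta_mx _ _ _ _]mxE (negPf ji) mulr0.
rewrite mxE (bigD1 i) //= big1 ?addr0; last first.
  by move=> j ji; rewrite !mxE (negPf ji) rmorph0 mul0r.
by rewrite !mxE !eqxx /= rmorph1 mul1r mulr1.
Qed.

Lemma psdmx_tr_ge0 n (A : 'M[K]_n) : psdmx A -> 0 <= \tr A.
Proof. by move=> pA; apply: sumr_ge0 => i _; apply: psdmx_diag_ge0. Qed.

(** Polarisation: positivity at $e_i+ce_j$ makes $cA_{ij}+\bar cA_{ji}$ real, and the choices $c=1$
    and $c=\mathrm i$ together identify $A_{ij}$ with the conjugate of $A_{ji}$. *)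
Lemma psdmx_herm n (A : 'M[K]_n) : psdmx A -> A^t* = A.
Proof.
move=> pA; apply/matrixP => i j.
have Q (c : K) : c * A i j + c^* * A j i \is Num.real.
  have := pA (delta_mx i 0 + c *: delta_mx j 0).
  rewrite dagD dagZ !mulmxDl !mulmxDr -!scalemxAl -!scalemxAr.
  have E u v : ((delta_mx u (0 : 'I_1))^t* *m A *m delta_mx v (0 : 'I_1)) 0 0 = A u v.
    rewrite mxE (bigD1 v) //= big1 ?addr0; last first.
      by move=> l lv; rewrite [delta_mx _ _ _ _]mxE (negPf lv) mulr0.
    rewrite mxE (bigD1 u) //= big1 ?addr0; last first.
      by move=> l lu; rewrite !mxE (negPf lu) rmorph0 mul0r.
    by rewrite !mxE !eqxx /= rmorph1 mul1r mulr1.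
  have mE (P P' : 'M[K]_1) : (P + P') 0 0 = P 0 0 + P' 0 0 by rewrite mxE.
  have sE a (P : 'M[K]_1) : (a *: P) 0 0 = a * P 0 0 by rewrite mxE.
  rewrite !(mE, sE) !E => /ger0_real h.
  have h1 := ger0_real (psdmx_diag_ge0 i pA).
  have h2 : c * (c^* * A j j) \is Num.real.
    by rewrite mulrA rpredM // ?ger0_real ?mul_conjC_ge0 // psdmx_diag_ge0.
  have realE (p q : K) : p = q -> p \is Num.real -> q \is Num.real by move=> ->.
  by apply: (realE _ _ _ (rpredB (rpredB h h1) h2)); ring.
have := CrealP (Q 1); have := CrealP (Q 'i); rewrite !mxE.
rewrite !rmorphD !rmorphM !rmorph1 /= !conjCi !mul1r
  rmorphN /= conjCi opprK => h1 h2.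
have h3 : (A j i)^* - (A i j)^* = A i j - A j i.
  apply: (mulfI (neq0Ci K)); rewrite !mulrBr; move: h1; rewrite !mulNr => h1.
  by rewrite -h1; ring.
have : 2 * (A j i)^* = 2 * A i j.
  have -> : 2 * (A j i)^* = ((A j i)^* - (A i j)^*) + ((A i j)^* + (A j i)^*) by ring.
  by rewrite h3 h2; ring.
by apply: mulfI; rewrite pnatr_eq0.
Qed.

Lemma hermitian_spectral n (A : 'M[K]_n) : A^t* = A ->
  exists (P : 'M[K]_n) (D : 'rV[K]_n), [/\ P \is unitarymx, forall i, D 0 i \is Num.real &
                A = P^t* *m diag_mx D *m P].
Proof.
move=> hA; have hA' : A \is hermsymmx.
  by apply/is_hermitianmxP; rewrite expr0 scale1r hA.
exists (spectralmx A), (spectral_diag A); split.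
- exact: spectral_unitarymx.
- by move=> i; have /mxOverP := hermitian_spectral_diag_real hA'; apply.
- have /orthomx_spectralP {1}-> := hermitian_normalmx hA'.
  by rewrite invmx_unitary // spectral_unitarymx.
Qed.

Lemma unitary_dagl n (P : 'M[K]_n) : P \is unitarymx -> P^t* *m P = 1%:M.
Proof. by rewrite -trmxC_unitary => /unitarymxP; rewrite trmxCK. Qed.

Lemma psdmx_spectral n (A : 'M[K]_n) : psdmx A ->
  exists (P : 'M[K]_n) (D : 'rV[K]_n), [/\ P \is unitarymx, forall i, 0 <= D 0 i &
                A = P^t* *m diag_mx D *m P].
Proof.
move=> pA; have [P [D [uP _ E]]] := hermitian_spectral (psdmx_herm pA).
exists P, D; split => // i.
have := psdmx_diag_ge0 i (psdmx_congr P pA).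
rewrite {1}E !mulmxA (unitarymxP uP) mul1mx -mulmxA (unitarymxP uP) mulmx1.
by rewrite mxE eqxx mulr1n.
Qed.

Lemma psdmx_diag n (D : 'rV[K]_n) : (forall i, 0 <= D 0 i) -> psdmx (diag_mx D).
Proof.
move=> D0; pose s : 'rV[K]_n := \row_i sqrtC (D 0 i).
have sr i : s 0 i \is Num.real by rewrite mxE ger0_real // sqrtC_ge0.
have -> : diag_mx D = diag_mx s *m (diag_mx s)^t*.
  rewrite dag_diag // mulmx_diag; congr diag_mx; apply/rowP => i.
  by rewrite !mxE -expr2 sqrtCK.
exact: psdmx_gram.
Qed.

Lemma psdmx_sqrt n (A : 'M[K]_n) : psdmx A -> exists2 B, psdmx B & B *m B = A.
Proof.
move=> pA; have [P [D [uP D0 ->]]] := psdmx_spectral pA.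
pose s : 'rV[K]_n := \row_i sqrtC (D 0 i).
exists (P^t* *m diag_mx s *m P).
  have := @psdmx_congr n n (diag_mx s) (P^t*); rewrite trmxCK; apply.
  by apply: psdmx_diag => i; rewrite mxE sqrtC_ge0.
rewrite !mulmxA; congr (_ *m _); rewrite -!mulmxA; congr (_ *m _).
rewrite [P *m _]mulmxA (unitarymxP uP) mul1mx mulmx_diag; congr diag_mx.
by apply/rowP => i; rewrite !mxE -expr2 sqrtCK.
Qed.

Lemma mxtrace_unitary n (P A : 'M[K]_n) : P \is unitarymx ->
  \tr (P *m A *m P^t*) = \tr A.
Proof. by move=> uP; rewrite mxtrace_mulC mulmxA unitary_dagl // mul1mx. Qed.

(* In an eigenbasis of M, the norms of the columns of X are the eigenvalues of M. *)
Lemma Re_tr_le_tr_abs n (M X : 'M[K]_n) : psdmx M -> M *m M = X^t* *m X ->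
  'Re (\tr X) <= \tr M.
Proof.
move=> pM MX; have [P [D [uP D0 ME]]] := psdmx_spectral pM.
rewrite -(mxtrace_unitary X uP); set Y := P *m X *m P^t*.
have -> : \tr M = \tr (diag_mx D).
  by rewrite ME mxtrace_mulC mulmxA (unitarymxP uP) mul1mx.
have YY : Y^t* *m Y = diag_mx D *m diag_mx D.
  rewrite /Y !dagM trmxCK -!mulmxA [P^t* *m (P *m _)]mulmxA unitary_dagl // mul1mx.
  rewrite [X^t* *m (X *m _)]mulmxA -MX ME.
  by rewrite !mulmxA (unitarymxP uP) mul1mx -!mulmxA (unitarymxP uP) mulmx1
    [P *m (P^t* *m _)]mulmxA (unitarymxP uP) mul1mx.
clearbody Y; rewrite raddf_sum /=; apply: ler_sum => i _.
rewrite [diag_mx D i i]mxE eqxx mulr1n.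
have h : `|Y i i| <= D 0 i.
  rewrite -(@ler_pXn2r _ 2) ?nnegrE // ?D0 //.
  have <- : (Y^t* *m Y) i i = D 0 i ^+ 2.
    by rewrite YY mulmx_diag !mxE eqxx mulr1n expr2.
  have YtE j : (Y^t*) i j = (Y j i)^* by rewrite !mxE.
  rewrite mxE (bigD1 i) //= YtE normCK mulrC lerDl.
  by apply: sumr_ge0 => j _; rewrite YtE mulrC mul_conjC_ge0.
apply: le_trans h; apply: (le_trans _ (leif_normC_Re_Creal (Y i i))).
by rewrite real_ler_norm // Creal_Re.
Qed.

Lemma conj_unitaryM n (U A B : 'M[K]_n) : U \is unitarymx ->
  (U *m A *m U^t*) *m (U *m B *m U^t*) = U *m (A *m B) *m U^t*.
Proof.
by move=> uU; rewrite -!mulmxA [U^t* *m (U *m _)]mulmxA unitary_dagl // mul1mx.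
Qed.

(** In an eigenbasis of $A-B$ with eigenvalues $D_i$, writing $A^2-B^2$ as half the anticommutator
    of $A-B$ and $A+B$ gives $P_{ii}-Q_{ii}=D_i(A_{ii}+B_{ii})$. Since $|D_i|=|A_{ii}-B_{ii}|\le
    A_{ii}+B_{ii}$, it follows that $D_i^2\le|P_{ii}-Q_{ii}|\le P_{ii}+Q_{ii}$. *)
Lemma powers_stormer n (A B P Q : 'M[K]_n) :
  psdmx A -> psdmx B -> psdmx P -> psdmx Q -> A *m A - B *m B = P - Q ->
  \tr ((A - B) *m (A - B)) <= \tr P + \tr Q.
Proof.
move=> pA pB pP pQ AB.
have [|W [D [uW Dr E]]] := @hermitian_spectral n (A - B).
  by rewrite dagB (psdmx_herm pA) (psdmx_herm pB).
have cB X Y : W *m (X - Y) *m W^t* = W *m X *m W^t* - W *m Y *m W^t*.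
  by rewrite mulmxBr mulmxBl.
rewrite -(mxtrace_unitary P uW) -(mxtrace_unitary Q uW).
rewrite -(mxtrace_unitary _ uW) -(conj_unitaryM _ _ uW).
have ED : W *m (A - B) *m W^t* = diag_mx D.
  by rewrite E !mulmxA (unitarymxP uW) mul1mx -mulmxA (unitarymxP uW) mulmx1.
have AB' := congr1 (fun X => W *m X *m W^t*) AB; rewrite /= !cB -!(conj_unitaryM _ _ uW) in AB'.
rewrite ED mulmx_diag; rewrite cB in ED.
have {}pA := psdmx_congr W pA; have {}pB := psdmx_congr W pB.
have {}pP := psdmx_congr W pP; have {}pQ := psdmx_congr W pQ.
move: (W *m A *m _) (W *m B *m _) (W *m P *m _) (W *m Q *m _) ED AB' pA pB pP pQ.
move=> {A B P Q AB E} A B P Q ED AB pA pB pP pQ.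
rewrite -mxtraceD; apply: ler_sum => i _.
rewrite !mxE eqxx mulr1n.
have A0 := psdmx_diag_ge0 i pA; have B0 := psdmx_diag_ge0 i pB.
have P0 := psdmx_diag_ge0 i pP; have Q0 := psdmx_diag_ge0 i pQ.
have Di : D 0 i = A i i - B i i.
  by have := congr1 (fun X : 'M[K]_n => X i i) ED; rewrite /= !mxE eqxx mulr1n.
have H : 2 * (P i i - Q i i) = 2 * (D 0 i * (A i i + B i i)).
  have -> : P i i - Q i i = (P - Q) i i by rewrite !mxE.
  have -> : 2 * (P - Q) i i = (P - Q + (P - Q)) i i by rewrite [RHS]mxE mulrDl mul1r.
  have -> : P - Q + (P - Q) = diag_mx D *m (A + B) + (A + B) *m diag_mx D.
    rewrite -AB -ED !mulmxBl !mulmxBr !mulmxDr !mulmxDl.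
    move: (A *m A) (A *m B) (B *m A) (B *m B) => a b c d.
    by rewrite !opprD !addrA; apply/matrixP => u v; rewrite !mxE; ring.
  by rewrite mul_diag_mx mul_mx_diag !mxE; ring.
have {}H : P i i - Q i i = D 0 i * (A i i + B i i) by apply: mulfI H; rewrite pnatr_eq0.
have n1 : `|D 0 i| <= A i i + B i i.
  by rewrite Di; apply: le_trans (ler_normB _ _) _; rewrite !ger0_norm.
apply: (le_trans (y := `|P i i - Q i i|)); last first.
  by apply: le_trans (ler_normB _ _) _; rewrite !ger0_norm.
rewrite H normrM [X in _ <= _ * X]ger0_norm ?addr_ge0 //.
apply: (le_trans (y := `|D 0 i| * `|D 0 i|)); last by rewrite ler_wpM2l.
by rewrite -!expr2 real_normK.
Qed.

(** If $W^*W$ is a projection, then $Z=WW^*W-W$ satisfies $Z^*Z=0$, so $WW^*W=W$. Hence $1-WW^*$ is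
    a self-adjoint idempotent and equals its own Gram matrix. *)
Lemma partial_isometry n (W : 'M[K]_n) :
  W^t* *m W *m (W^t* *m W) = W^t* *m W -> psdmx (1%:M - W *m W^t*).
Proof.
move=> WdW2.
have hG : (W *m W^t*)^t* = W *m W^t* by rewrite dagM trmxCK.
have WP : W *m (W^t* *m W) = W.
  have : (W *m (W^t* *m W) - W)^t* *m (W *m (W^t* *m W) - W) = 0.
    rewrite dagB !dagM trmxCK mulmxBl !mulmxBr.
    have e1 : W^t* *m W *m W^t* *m (W *m (W^t* *m W)) = W^t* *m W.
      by rewrite -!mulmxA [W^t* *m (W *m (W^t* *m W))]mulmxA WdW2 mulmxA WdW2.
    have e2 : W^t* *m W *m W^t* *m W = W^t* *m W by rewrite -mulmxA WdW2.
    have e3 : W^t* *m (W *m (W^t* *m W)) = W^t* *m W by rewrite mulmxA WdW2.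
    by rewrite e1 e2 e3 !subrr.
  set Z := _ - W; move=> Z0; apply/eqP; rewrite -subr_eq0 -/Z; apply/eqP.
  clearbody Z; apply/matrixP => i j; rewrite [RHS]mxE.
  have : (Z^t* *m Z) j j = 0 by rewrite Z0 mxE.
  rewrite mxE => /eqP; rewrite psumr_eq0; last first.
    by move=> l _; rewrite !mxE mulrC mul_conjC_ge0.
  by move=> /allP/(_ i (mem_index_enum _)) /=; rewrite !mxE mulrC mul_conjC_eq0 => /eqP.
have -> : 1%:M - W *m W^t* = (1%:M - W *m W^t*) *m (1%:M - W *m W^t*)^t*.
  rewrite dagB hG trmx1 map_mx1 mulmxBl mul1mx mulmxBr mulmx1.
  by rewrite -[W *m W^t* *m (W *m _)]mulmxA [W^t* *m (W *m _)]mulmxA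
    [W *m (_ *m _)]mulmxA WP subrr subr0.
exact: psdmx_gram.
Qed.

(** * Fuchs-van de Graaf type inequalities, with A and B the square roots of the two states and tr M
    their fidelity *)

Section FidelityBounds.
Variables (n : nat) (A B M : 'M[K]_n).
Hypotheses (pA : psdmx A) (pB : psdmx B) (pM : psdmx M).
Hypothesis MM : M *m M = B *m (A *m A) *m B.
Hypotheses (trA : \tr (A *m A) = 1) (trB : \tr (B *m B) = 1).

Let MX : M *m M = (A *m B)^t* *m (A *m B).
Proof. by rewrite MM dagM (psdmx_herm pA) (psdmx_herm pB) !mulmxA. Qed.

(** The fidelity is at least $\operatorname{tr}AB=1-\operatorname{tr}(A-B)^2/2$, and
    [powers_stormer] controls the square. *)
Lemma fidelity_ge_tracedist P Q : psdmx P -> psdmx Q ->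
  A *m A - B *m B = P - Q -> 1 - (\tr P + \tr Q) / 2 <= \tr M.
Proof.
move=> pP pQ /(powers_stormer pA pB pP pQ) ps.
apply: le_trans (Re_tr_le_tr_abs pM MX).
have tE : \tr ((A - B) *m (A - B)) = 2 - 2 * \tr (A *m B).
  rewrite mulmxBr !mulmxBl !raddfB /= trA trB (mxtrace_mulC B A); ring.
have h0 : 0 <= \tr ((A - B) *m (A - B)).
  have hAB : (A - B)^t* = A - B by rewrite dagB (psdmx_herm pA) (psdmx_herm pB).
  by rewrite -{2}hAB; apply: psdmx_tr_ge0; apply: psdmx_gram.
have tE2 : \tr (A *m B) = 1 - \tr ((A - B) *m (A - B)) / 2.
  by rewrite tE; field.
have tr_real : \tr (A *m B) \is Num.real.
  by rewrite tE2 rpredB ?rpred1 // rpredM ?ger0_real // invr_ge0 ler0n.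
move/Creal_ReP: tr_real => ->.
by rewrite tE2 lerD2l lerN2 ler_pM2r // invr_gt0 ltr0n.
Qed.

(** By [MX], [M] is the absolute value of $AB$; the contraction is the partial isometry of the polar
    decomposition $AB=WM$. *)
Lemma polar_contraction : exists W : 'M[K]_n,
  psdmx (1%:M - W *m W^t*) /\ W^t* *m (A *m B) = M.
Proof.
have [P [D [uP D0 ME]]] := psdmx_spectral pM.
have Dr i : D 0 i \is Num.real by rewrite ger0_real.
(* Because $0^{-1}=0$, the matrix [N] built from these entries is the pseudo-inverse of [M], and
   singular [M] is covered. *)
pose D' : 'rV[K]_n := \row_i (D 0 i)^-1.
have D'r i : D' 0 i \is Num.real by rewrite mxE rpredV.
pose N := P^t* *m diag_mx D' *m P.
have hN : N^t* = N by rewrite /N !dagM trmxCK dag_diag // !mulmxA.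
have mulc (F G : 'rV[K]_n) : (P^t* *m diag_mx F *m P) *m (P^t* *m diag_mx G *m P) =
    P^t* *m diag_mx (\row_i (F 0 i * G 0 i)) *m P.
  by rewrite -!mulmxA [P *m (P^t* *m _)]mulmxA (unitarymxP uP) mul1mx
    [diag_mx F *m (_ *m _)]mulmxA mulmx_diag.
have NMM : N *m (M *m M) = M.
  rewrite ME /N !mulc; congr (_ *m diag_mx _ *m _); apply/rowP => i; rewrite !mxE.
  have [->|D0'] := eqVneq (D 0 i) 0; first by rewrite !mulr0.
  by rewrite mulrA mulVf // mul1r.
have NMMN : (N *m (M *m M) *m N) *m (N *m (M *m M) *m N) = N *m (M *m M) *m N.
  rewrite NMM ME /N !mulc; congr (_ *m diag_mx _ *m _); apply/rowP => i; rewrite !mxE.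
  have [->|D0'] := eqVneq (D 0 i) 0; first by rewrite !mul0r.
  by rewrite divff // mulr1.
pose W := A *m B *m N.
have Wd : W^t* = N *m (A *m B)^t* by rewrite /W [(_ *m N)^t*]dagM hN.
exists W; split; last by rewrite Wd -mulmxA -MX.
have WdW : W^t* *m W = N *m (M *m M) *m N by rewrite Wd /W MX !mulmxA.
have WdW2 : W^t* *m W *m (W^t* *m W) = W^t* *m W by rewrite WdW NMMN.
exact: partial_isometry.
Qed.

(* With G = A W, the contraction W turns the fidelity into the inner product of G and B;
   then G G^* - B B^* is half the anticommutator of G - B and G + B, which splits into a
   difference of squares after rescaling by s. *)
Lemma tracedist_le_fidelity s : 0 < s -> \tr M <= 1 /\
  exists P Q, [/\ psdmx P, psdmx Q, A *m A - B *m B = P - Q &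
    \tr P + \tr Q <= (2 - 2 * \tr M) + (s ^+ 2 * (2 - 2 * \tr M) + 4 / s ^+ 2) / 2].
Proof.
move=> s0; have [W [pW WM]] := polar_contraction.
have hA := psdmx_herm pA; have hB := psdmx_herm pB; have hM := psdmx_herm pM.
pose G := A *m W.
have pG : psdmx (A *m A - G *m G^t*).
  have := psdmx_congr A pW; rewrite mulmxBr mulmxBl mulmx1 hA /G dagM hA.
  by rewrite !mulmxA.
have GB : G^t* *m B = M by rewrite /G dagM hA -mulmxA.
have BG : B *m G = M by rewrite -{1}hB -[G]trmxCK -dagM GB hM.
have tG : \tr (G *m G^t*) <= 1.
  by have := psdmx_tr_ge0 pG; rewrite raddfB /= trA subr_ge0.
have tGX : \tr ((G - B) *m (G - B)^t*) = \tr (G *m G^t*) + 1 - 2 * \tr M.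
  rewrite dagB hB mulmxBr !mulmxBl !raddfB /= trB (mxtrace_mulC B) (mxtrace_mulC G B) GB BG.
  ring.
have tGY : \tr ((G + B) *m (G + B)^t*) = \tr (G *m G^t*) + 1 + 2 * \tr M.
  rewrite dagD hB mulmxDr !mulmxDl !raddfD /= trB (mxtrace_mulC B) (mxtrace_mulC G B) GB BG.
  ring.
have X0 := psdmx_tr_ge0 (psdmx_gram (G - B)).
have tM1 : \tr M <= 1.
  have : 0 <= 2 - 2 * \tr M.
    by apply: le_trans X0 _; rewrite tGX lerD2r -[2]/(1 + 1) lerD2r.
  by rewrite subr_ge0 -{2}[2]mulr1 ler_pM2l ?ltr0n.
split => //.
have sc : s^* = s by apply/CrealP; rewrite gtr0_real.
have sc' : (s^-1)^* = s^-1 by apply/CrealP; rewrite gtr0_real // invr_gt0.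
have sn : s != 0 by rewrite gt_eqF.
(* The scalings cancel in the cross terms $XY^*+YX^*$. The trace of $XX^*$ is at most
   $s^2(2-2\operatorname{tr}M)$, small near fidelity 1 for fixed [s], while that of $YY^*$ is at
   most $4/s^2$. *)
pose X := s *: (G - B); pose Y := s^-1 *: (G + B).
exists (A *m A - G *m G^t* + 4^-1 *: ((X + Y) *m (X + Y)^t*)),
  (4^-1 *: ((X - Y) *m (X - Y)^t*)); split.
- apply: psdmxD => //; apply: psdmxZ; last exact: psdmx_gram.
  by rewrite invr_ge0 ler0n.
- by apply: psdmxZ; [rewrite invr_ge0 ler0n|exact: psdmx_gram].
- rewrite -[in RHS]addrA -scalerBr.
  have -> : (X + Y) *m (X + Y)^t* - (X - Y) *m (X - Y)^t* = 2 *: (X *m Y^t* + Y *m X^t*).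
    rewrite dagD dagB !(mulmxBr, mulmxBl) !(mulmxDr, mulmxDl).
    move: (X *m X^t*) (X *m Y^t*) (Y *m X^t*) (Y *m Y^t*) => a b c d.
    by apply/matrixP => u v; rewrite !mxE; ring.
  have -> : X *m Y^t* + Y *m X^t* = 2 *: (G *m G^t* - B *m B).
    rewrite /X /Y !dagZ sc sc' -!scalemxAl -!scalemxAr !scalerA divff // mulVf // !scale1r.
    rewrite dagD dagB hB !(mulmxBr, mulmxBl) !(mulmxDr, mulmxDl).
    move: (G *m G^t*) (G *m B) (B *m G^t*) (B *m B) => a b c d.
    by apply/matrixP => u v; rewrite !mxE; ring.
  move: (A *m A) (G *m G^t*) (B *m B) => a b c.
  by apply/matrixP => u v; rewrite !mxE; field.
rewrite raddfD /= raddfB /= trA !mxtraceZ.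
have -> : 1 - \tr (G *m G^t*) + 4^-1 * \tr ((X + Y) *m (X + Y)^t*) +
    4^-1 * \tr ((X - Y) *m (X - Y)^t*) = 1 - \tr (G *m G^t*) +
    (\tr (X *m X^t*) + \tr (Y *m Y^t*)) / 2.
  rewrite dagD dagB !(mulmxBr, mulmxBl) !(mulmxDr, mulmxDl).
  rewrite !raddfD /= !raddfN /=.
  move: (\tr (X *m X^t*)) (\tr (X *m Y^t*)) (\tr (Y *m X^t*)) (\tr (Y *m Y^t*)) => a b c d.
  by field.
have -> : \tr (X *m X^t*) = s ^+ 2 * (\tr (G *m G^t*) + 1 - 2 * \tr M).
  by rewrite /X dagZ sc -scalemxAl -scalemxAr scalerA mxtraceZ tGX expr2.
have -> : \tr (Y *m Y^t*) = (\tr (G *m G^t*) + 1 + 2 * \tr M) / s ^+ 2.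
  by rewrite /Y dagZ sc' -scalemxAl -scalemxAr scalerA mxtraceZ tGY mulrC expr2 invfM.
have M0 := psdmx_tr_ge0 pM.
have tG2 : 2 * \tr M - 1 <= \tr (G *m G^t*).
  rewrite -subr_ge0.
  have -> : \tr (G *m G^t*) - (2 * \tr M - 1) = \tr (G *m G^t*) + 1 - 2 * \tr M by ring.
  by rewrite -tGX.
apply: lerD.
  have -> : 2 - 2 * \tr M = 1 - (2 * \tr M - 1) by ring.
  by rewrite lerD2l lerN2.
rewrite ler_pM2r ?invr_gt0 ?ltr0n //; apply: lerD.
  rewrite ler_wpM2l ?exprn_ge0 ?(ltW s0) // lerD2r.
  by rewrite -[2]/(1 + 1) lerD2r.
rewrite ler_pM2r ?invr_gt0 ?exprn_gt0 //.
have -> : 4 = 1 + 1 + 2 * 1 :> K by ring.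
by apply: lerD; [rewrite lerD2r | rewrite ler_pM2l ?ltr0n].
Qed.

End FidelityBounds.

End PsdMatrices.

(** * Operators indexed by finite types, their square roots and trace distance *)

Section Operators.
Variable T : finType.
Implicit Types A P Q : Op T.

Definition mxop A : 'M[C]_#|T| := \matrix_(i, j) A (enum_val i) (enum_val j).
Definition opmx (B : 'M[C]_#|T|) : Op T := fun x y => B (enum_rank x) (enum_rank y).

Lemma opmxK B : mxop (opmx B) = B.
Proof. by apply/matrixP => i j; rewrite mxE /opmx !enum_valK. Qed.

Lemma mxopK A : opmx (mxop A) = A.
Proof. by apply: funext => x; apply: funext => y; rewrite /opmx mxE !enum_rankK. Qed.

Lemma sum_enum_val (F : T -> C) : \sum_x F x = \sum_(i < #|T|) F (enum_val i).
Proof. exact: (big_enum_val (A := T)). Qed.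

Lemma mxop_mul A (B : Op T) : mxop (opmul A B) = mxop A *m mxop B.
Proof.
apply/matrixP => i j; rewrite !mxE /opmul sum_enum_val.
by apply: eq_bigr => l _; rewrite !mxE.
Qed.

Lemma tr_mxop A : tr A = \tr (mxop A).
Proof. by rewrite /tr sum_enum_val; apply: eq_bigr => i _; rewrite mxE. Qed.

Lemma psd_mxop A : psd A <-> psdmx (mxop A).
Proof.
have E (w : T -> C) (v : 'cV[C]_#|T|) : (forall i, v i 0 = w (enum_val i)) ->
    ((map_mx Num.conj v^T) *m mxop A *m v) 0 0 =
    \sum_x \sum_y (w x)^* * A x y * w y.
  move=> vw; rewrite mxE exchange_big /= sum_enum_val; apply: eq_bigr => i _.
  rewrite mxE vw mulr_suml sum_enum_val; apply: eq_bigr => j _.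
  by rewrite !mxE vw.
split=> pA v.
  rewrite (E (fun x => v (enum_rank x) 0)); first exact: pA.
  by move=> i; rewrite enum_valK.
rewrite -(E v (\col_i v (enum_val i))); first exact: pA.
by move=> i; rewrite mxE.
Qed.

Lemma psd_trC A : psd A -> tr A = real_complex _ (complex.Re (tr A)).
Proof.
move=> /psd_mxop pA; rewrite RRe_real // ger0_real // tr_mxop.
exact: psdmx_tr_ge0.
Qed.

Lemma psd_Re_tr_ge0 A : psd A -> 0 <= complex.Re (tr A).
Proof.
move=> /psd_mxop /psdmx_tr_ge0; rewrite -tr_mxop lecE => /andP[_ h].
exact: h.
Qed.

Lemma sqrtmP A : psd A -> psd (sqrtm A) /\ opmul (sqrtm A) (sqrtm A) = A.
Proof.
move=> /psd_mxop pA; refine (epsilon_spec (inhabits (fun _ _ => 0))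
  (fun B => psd B /\ opmul B B = A) _).
have [B pB BB] := psdmx_sqrt pA.
exists (opmx B); split; first by apply/psd_mxop; rewrite opmxK.
by rewrite -[LHS]mxopK mxop_mul opmxK BB mxopK.
Qed.

(* Encodes |A - B|_1 <= t; with a decomposition into positive parts instead of the spectrum,
   contractivity under channels is immediate. *)
Definition tracedist_le (t : Rr) A (B : Op T) : Prop := exists P Q,
  [/\ psd P, psd Q, forall x y, A x y - B x y = P x y - Q x y &
      complex.Re (tr P) + complex.Re (tr Q) <= t].

Lemma psd0 : psd (fun _ _ : T => 0 : C).
Proof.
by move=> v; apply: sumr_ge0 => x _; apply: sumr_ge0 => y _; rewrite mulr0 mul0r.
Qed.

Lemma psdD P Q : psd P -> psd Q -> psd (fun x y => P x y + Q x y).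
Proof.
move=> pP pQ v.
rewrite (eq_bigr (fun x => \sum_y (v x)^* * P x y * v y + \sum_y (v x)^* * Q x y * v y)).
  by rewrite big_split addr_ge0 ?pP ?pQ.
move=> x _; rewrite -big_split /=; apply: eq_bigr => y _.
by rewrite mulrDr mulrDl.
Qed.

Lemma trD P Q : tr (fun x y => P x y + Q x y) = tr P + tr Q.
Proof. by rewrite /tr big_split. Qed.

Lemma tracedist_refl A : tracedist_le 0 A A.
Proof.
exists (fun _ _ => 0), (fun _ _ => 0); split; try exact: psd0.
  by move=> x y; rewrite !subrr.
by rewrite /tr big1 //= addr0.
Qed.

Lemma tracedist_trans s t A B D :
  tracedist_le s A B -> tracedist_le t B D -> tracedist_le (s + t) A D.
Proof.
move=> [P [Q [pP pQ AB PQ]]] [P' [Q' [pP' pQ' BD PQ']]].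
exists (fun x y => P x y + P' x y), (fun x y => Q x y + Q' x y).
split; try exact: psdD.
  move=> x y; rewrite -[A x y](subrK (B x y)) AB -addrA BD; ring.
by rewrite !trD !raddfD /=; lra.
Qed.

Lemma tracedist_le_mono s t A B : s <= t -> tracedist_le s A B -> tracedist_le t A B.
Proof.
move=> st [P [Q [pP pQ AB PQ]]]; exists P, Q; split => //; exact: le_trans PQ st.
Qed.

Section TwoStates.
Variables rho sigma : Op T.
Hypotheses (rs : is_state rho) (ss : is_state sigma).

Let A := mxop (sqrtm rho).
Let B := mxop (sqrtm sigma).
Let F := opmul (opmul (sqrtm sigma) rho) (sqrtm sigma).
Let M := mxop (sqrtm F).

Let pA : psdmx A. Proof. by apply/psd_mxop; case: (sqrtmP (proj1 rs)). Qed.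
Let pB : psdmx B. Proof. by apply/psd_mxop; case: (sqrtmP (proj1 ss)). Qed.
Let AA : A *m A = mxop rho.
Proof. by rewrite -mxop_mul; congr mxop; case: (sqrtmP (proj1 rs)). Qed.
Let BB : B *m B = mxop sigma.
Proof. by rewrite -mxop_mul; congr mxop; case: (sqrtmP (proj1 ss)). Qed.

Let FE : mxop F = B *m (A *m A) *m B. Proof. by rewrite !mxop_mul AA. Qed.

Let pF : psd F.
Proof.
apply/psd_mxop; rewrite FE AA -{2}(psdmx_herm pB).
by apply: psdmx_congr; apply/psd_mxop; case: rs.
Qed.

Let pM : psdmx M. Proof. by apply/psd_mxop; case: (sqrtmP pF). Qed.
Let MM : M *m M = B *m (A *m A) *m B.
Proof. by rewrite -FE -mxop_mul; congr mxop; case: (sqrtmP pF). Qed.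
Let trA : \tr (A *m A) = 1. Proof. by rewrite AA -tr_mxop; case: rs. Qed.
Let trB : \tr (B *m B) = 1. Proof. by rewrite BB -tr_mxop; case: ss. Qed.

Let fE : \tr M = real_complex _ (fidelity rho sigma).
Proof. by rewrite /M -tr_mxop psd_trC //; case: (sqrtmP pF). Qed.

Lemma fidelity_ge0 : 0 <= fidelity rho sigma.
Proof. by apply: psd_Re_tr_ge0; case: (sqrtmP pF). Qed.

Lemma fidelity_ge_of_tracedist t : tracedist_le t rho sigma ->
  1 - t / 2 <= fidelity rho sigma.
Proof.
move=> [P [Q [pP pQ E tPQ]]].
have EM : A *m A - B *m B = mxop P - mxop Q.
  by rewrite AA BB; apply/matrixP => i j; rewrite !mxE E.
have := fidelity_ge_tracedist pA pB pM MM trA trB (proj1 (psd_mxop P) pP)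
  (proj1 (psd_mxop Q) pQ) EM.
rewrite fE -!tr_mxop (psd_trC pP) (psd_trC pQ).
have -> : 1 - (real_complex Rr (complex.Re (tr P)) + real_complex _ (complex.Re (tr Q))) / 2 =
   real_complex _ (1 - (complex.Re (tr P) + complex.Re (tr Q)) / 2).
  by rewrite rmorphB rmorph1 rmorphM fmorphV !rmorphD /= rmorph1.
rewrite lecR; lra.
Qed.

Lemma tracedist_of_fidelity s : 0 < s -> fidelity rho sigma <= 1 /\
  let h := 2 - 2 * fidelity rho sigma in
  tracedist_le (h + (s ^+ 2 * h + 4 / s ^+ 2) / 2) rho sigma.
Proof.
move=> s0; have s0' : 0 < real_complex Rr s by rewrite ltcR.
have [M1 [P [Q [pP pQ E tPQ]]]] := tracedist_le_fidelity pA pB pM MM trA trB s0'.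
split; first by move: M1; rewrite fE -(rmorph1 (real_complex Rr)) lecR.
have pP' : psd (opmx P) by apply/psd_mxop; rewrite opmxK.
have pQ' : psd (opmx Q) by apply/psd_mxop; rewrite opmxK.
exists (opmx P), (opmx Q); split => //.
  move=> x y; have := congr1 (fun X => opmx X x y) E.
  by rewrite /opmx AA BB !mxE !enum_rankK.
move: tPQ; rewrite fE -{1}[P]opmxK -{1}[Q]opmxK -!tr_mxop (psd_trC pP') (psd_trC pQ').
have E1 : 2 - 2 * real_complex Rr (fidelity rho sigma) =
    real_complex _ (2 - 2 * fidelity rho sigma).
  by rewrite rmorphB rmorphM rmorphD /= rmorph1.
rewrite E1.
have -> : forall h : Rr, real_complex Rr h + (real_complex _ s ^+ 2 * real_complex _ h +
    4 / real_complex _ s ^+ 2) / 2 = real_complex _ (h + (s ^+ 2 * h + 4 / s ^+ 2) / 2).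
  move=> h; rewrite !(rmorphD, rmorphM, fmorphV, rmorphXn) /=.
  by rewrite !rmorph1.
by rewrite -(rmorphD (real_complex Rr)) lecR.
Qed.

End TwoStates.

End Operators.

(** * Dimension-free comparison of purified distance and trace distance *)

Lemma tracedist_of_pdist (t : Rr) : 0 < t -> exists2 e : Rr, 0 < e &
  forall (T : finType) (rho sigma : Op T), is_state rho -> is_state sigma ->
  pdist rho sigma <= e -> tracedist_le t rho sigma.
Proof.
(* [s] makes $4/s^2\le t$, so that this term of the bound takes at most half of [t]. The value of
   [e2] gives the other half to the terms in $h=2-2F$, using $1-F\le1-F^2\le e_2$. *)
move=> t0; pose s : Rr := 1 + 4 / t.
have q0 : 0 < 4 / t by rewrite divr_gt0.
have s1 : 1 <= s by rewrite /s; lra.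
have s0 : 0 < s by lra.
have h1 : 4 / s ^+ 2 <= t.
  rewrite ler_pdivrMr ?exprn_gt0 //.
  have : 4 <= t * s by rewrite /s mulrDr mulrCA divff ?gt_eqF //; lra.
  by rewrite expr2; nra.
pose e2 : Rr := t / (2 * (2 + s ^+ 2)).
have d0 : 0 < 2 * (2 + s ^+ 2) by nra.
have e20 : 0 < e2 by rewrite divr_gt0.
exists (Num.sqrt e2); first by rewrite sqrtr_gt0.
move=> T rho sigma rs ss; rewrite /pdist ler_sqrt; last exact: ltW.
have f0 := fidelity_ge0 rs ss.
have [f1 H] := tracedist_of_fidelity rs ss s0.
move: H => /=; set f := fidelity _ _ in f0 f1 *.
move=> H fe; apply: tracedist_le_mono H.
have h2 : e2 * (2 * (2 + s ^+ 2)) = t by rewrite /e2 divfK // gt_eqF.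
have h3 : 1 - f <= e2 by nra.
have s2 : 0 <= s ^+ 2 by rewrite exprn_ge0 // ltW.
nra.
Qed.

Lemma pdist_of_tracedist (e : Rr) : 0 < e -> exists2 t : Rr, 0 < t &
  forall (T : finType) (rho sigma : Op T), is_state rho -> is_state sigma ->
  tracedist_le t rho sigma -> pdist rho sigma <= e.
Proof.
(* From $F\ge1-t/2\ge0$ one gets $1-F^2\le t\le e^2$; the cap at 1 secures the sign needed for
   squaring. *)
move=> e0; pose t := Num.min 1 (e ^+ 2).
have e2 : 0 < e ^+ 2 by rewrite exprn_gt0.
have t0 : 0 < t by rewrite lt_min ltr01 e2.
have t1 : t <= 1 by rewrite ge_min lexx.
have te : t <= e ^+ 2 by rewrite ge_min lexx orbT.
exists t => // T rho sigma rs ss /(fidelity_ge_of_tracedist rs ss) h.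
rewrite /pdist -[leRHS](ger0_norm (ltW e0)) -sqrtr_sqr ler_sqrt ?ltW //.
have f0 := fidelity_ge0 rs ss; nra.
Qed.

(** * LOCC instruments *)

Lemma sum_prod_Idx k (d : 'I_k -> nat) (F : forall i, 'I_(d i) -> C) :
  \sum_(a : Idx d) \prod_i F i (a i) = \prod_i \sum_(c < d i) F i c.
Proof.
pose T_ i : finType := 'I_(d i).
under [RHS]eq_bigr do rewrite (big_tag (T_ := T_) F).
rewrite bigA_distr_big_dep.
have /= H := @big_fprod C 0 1 *%R +%R 'I_k T_ (fun i => [ffun c => F i c]).
transitivity (\sum_(t : fprod T_) \prod_(i < k) [ffun c => F i c] (t i)); last first.
  rewrite H; apply: eq_bigr => g _; apply: eq_bigr => i _.
  by congr untag; apply: funext => x; rewrite ffunE.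
rewrite (reindex (@dffun_of_fprod _ T_)) /=; last exact/onW_bij/dffun_of_fprod_bij.
by apply: eq_bigr => t _; apply: eq_bigr => i _; rewrite !ffunE.
Qed.

Lemma prod_bool_natr (I : finType) (P : pred I) :
  \prod_i (P i)%:R = [forall i, P i]%:R :> C.
Proof.
case: forallP => [H|/forallP]; first by rewrite big1 // => i _; rewrite H.
rewrite negb_forall => /existsP[i /negPf Pi]; by rewrite (bigD1 i) //= Pi mul0r.
Qed.

Lemma eq_Idx k (d : 'I_k -> nat) (x y : Idx d) : [forall i, x i == y i] = (x == y).
Proof.
apply/forallP/eqP => [H|-> //]; apply/ffunP => i; exact/eqP.
Qed.

Lemma lcp_delta m n (Ks : seq 'M[C]_(n, m)) p q a b :
  lcp Ks (delta_mx p q) a b = \sum_(K <- Ks) K a p * (K b q)^*.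
Proof.
rewrite /lcp summxE; apply: eq_bigr => K _.
rewrite mxE (bigD1 q) //= big1 ?addr0; last first.
  move=> j jq; rewrite mxE big1 ?mul0r // => l _.
  by rewrite !mxE (negPf jq) andbF mulr0.
rewrite !mxE (bigD1 p) //= big1 ?addr0; last first.
  by move=> l lp; rewrite !mxE (negPf lp) mulr0.
by rewrite mxE !eqxx mulr1.
Qed.

Lemma kraus_sumE m n (Ks : seq 'M[C]_(n, m)) p q :
  kraus_sum Ks p q = \sum_(a < n) \sum_(K <- Ks) (K a p)^* * K a q.
Proof.
rewrite /kraus_sum summxE exchange_big; apply: eq_bigr => K _.
by rewrite mxE; apply: eq_bigr => a _; rewrite !mxE.
Qed.

Lemma sum_lcp_diag m n (Ks : seq 'M[C]_(n, m)) p q :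
  \sum_(a < n) lcp Ks (delta_mx p q) a a = kraus_sum Ks q p.
Proof.
rewrite kraus_sumE; apply: eq_bigr => a _; rewrite lcp_delta.
by apply: eq_bigr => K _; rewrite mulrC.
Qed.

Lemma psd_congr (T U : finType) (A : Op T) (G : U -> T -> C) : psd A ->
  psd (fun a b => \sum_x \sum_y A x y * (G a x * (G b y)^*)).
Proof.
move=> pA v; have := pA (fun x => \sum_a (G a x)^* * v a).
suff -> : \sum_x \sum_y (\sum_a (G a x)^* * v a)^* * A x y * (\sum_a (G a y)^* * v a) =
  \sum_a \sum_b (v a)^* * (\sum_x \sum_y A x y * (G a x * (G b y)^*)) * v b by [].
transitivity (\sum_x \sum_y \sum_a \sum_b
    (v a)^* * (A x y * (G a x * (G b y)^*)) * v b).
  apply: eq_bigr => x _; apply: eq_bigr => y _.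
  rewrite rmorph_sum !mulr_suml; apply: eq_bigr => a _.
  rewrite mulr_sumr; apply: eq_bigr => b _.
  by rewrite rmorphM /= conjCK; ring.
under eq_bigr do rewrite exchange_big /=.
rewrite exchange_big /=; apply: eq_bigr => a _.
under eq_bigr do rewrite exchange_big /=.
rewrite exchange_big /=; apply: eq_bigr => b _.
rewrite mulr_sumr mulr_suml; apply: eq_bigr => x _.
by rewrite mulr_sumr mulr_suml.
Qed.

Lemma psd_sum (T : finType) (I : finType) (P : pred I) (A : I -> Op T) :
  (forall i, P i -> psd (A i)) -> psd (fun a b => \sum_(i | P i) A i a b).
Proof.
move=> pA v.
have -> : \sum_a \sum_b (v a)^* * (\sum_(i | P i) A i a b) * v b =
    \sum_(i | P i) \sum_a \sum_b (v a)^* * A i a b * v b.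
  rewrite [RHS]exchange_big /=; apply: eq_bigr => a _.
  rewrite [RHS]exchange_big /=; apply: eq_bigr => b _.
  by rewrite mulr_sumr mulr_suml.
by apply: sumr_ge0 => i Pi; apply: pA.
Qed.

Section LOCCProperties.
Variable k : nat.
Implicit Types d e f : 'I_k -> nat.

(** Padding the local Kraus lists with zeros to a common length [N] lets one function [c] pick a
    Kraus operator for every party; the resulting tensor products are global Kraus operators, so
    positivity follows from [psd_congr]. *)
Lemma prodmap_kraus d e (K : forall i, seq 'M[C]_(e i, d i)) (A : kOp d) N :
  (forall i, (size (K i) <= N)%N) ->
  prodmap (fun i => lcp (K i)) A = fun a b =>
  \sum_(c : {ffun 'I_k -> 'I_N}) \sum_x \sum_y A x y *
    ((\prod_i (nth 0 (K i) (c i)) (a i) (x i)) *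
     (\prod_i (nth 0 (K i) (c i)) (b i) (y i))^*).
Proof.
move=> KN; apply: funext => a; apply: funext => b; rewrite /prodmap.
rewrite [RHS]exchange_big; apply: eq_bigr => x _ /=.
rewrite [RHS]exchange_big; apply: eq_bigr => y _ /=.
rewrite -mulr_sumr; congr (_ * _).
rewrite (eq_bigr (fun i => \sum_(l < N) (nth 0 (K i) l) (a i) (x i) *
    ((nth 0 (K i) l) (b i) (y i))^*)); last first.
  move=> i _; rewrite lcp_delta (big_nth 0).
  rewrite big_mkord (big_ord_widen N (fun l => (nth 0 (K i) l) (a i) (x i) *
    ((nth 0 (K i) l) (b i) (y i))^*) (KN i)) big_mkcond; apply: eq_bigr => l _.
  by case: ltnP => // lK; rewrite nth_default // !mxE mul0r.
rewrite bigA_distr_bigA; apply: eq_bigr => c _.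
by rewrite rmorph_prod -big_split.
Qed.

Lemma prodmap_psd d e (K : forall i, seq 'M[C]_(e i, d i)) (A : kOp d) :
  psd A -> psd (prodmap (fun i => lcp (K i)) A).
Proof.
move=> pA; rewrite (@prodmap_kraus _ _ _ _ (\max_i size (K i))); last first.
  by move=> i; apply: leq_bigmax_cond.
apply: psd_sum => c _.
exact: (psd_congr (fun (a : Idx e) (x : Idx d) => \prod_i (nth 0 (K i) (c i)) (a i) (x i)) pA).
Qed.

Lemma LOCC_psd d e (O : finType) (I : O -> kOp d -> kOp e) : LOCCinstr I ->
  forall o A, psd A -> psd (I o A).
Proof.
elim=> {d e O I} [d e O j K _ _ _|d m e O1 O2 I1 I2 _ IH1 _ IH2|d e O O' g I _ IH] o A pA.
- exact: prodmap_psd.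
- by apply: IH2; apply: IH1.
- by apply: psd_sum => o' _; apply: IH.
Qed.

Lemma LOCC_linear d e (O : finType) (I : O -> kOp d -> kOp e) : LOCCinstr I ->
  forall o c (A B : kOp d), I o (fun x y => c * A x y + B x y) =
    fun x y => c * I o A x y + I o B x y.
Proof.
elim=> {d e O I} [d e O j K _ _ _|d m e O1 O2 I1 I2 _ IH1 _ IH2|d e O O' g I _ IH] o c A B.
- apply: funext => a; apply: funext => b; rewrite /prodmap.
  rewrite mulr_sumr -big_split; apply: eq_bigr => x _ /=.
  rewrite mulr_sumr -big_split; apply: eq_bigr => y _ /=.
  by rewrite mulrDl mulrA.
- by rewrite IH1 IH2.
- apply: funext => a; apply: funext => b; rewrite mulr_sumr -big_split.
  by apply: eq_bigr => o' _; rewrite IH.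
Qed.

(** In a round the acting party [j] preserves the trace only after summation over outcomes, while
    the other factors are the identity for each outcome. The sum is therefore moved onto the factor
    of [j]. *)
Lemma LOCC_trace d e (O : finType) (I : O -> kOp d -> kOp e) : LOCCinstr I ->
  forall A, \sum_o tr (I o A) = tr A.
Proof.
elim=> {d e O I} [d e O j K Kc K1 Kj|d m e O1 O2 I1 I2 _ IH1 _ IH2|d e O O' g I _ IH] A.
- transitivity (\sum_x \sum_y A x y * (x == y)%:R); last first.
    apply: eq_bigr => x _; rewrite (bigD1 x) //= eqxx mulr1 big1 ?addr0 //.
    by move=> y yx; rewrite eq_sym (negPf yx) mulr0.
  transitivity (\sum_x \sum_y A x y *
      \sum_o \prod_i kraus_sum (K o i) (y i) (x i)).
    rewrite /tr /prodmap.
    under eq_bigr do rewrite exchange_big /=.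
    rewrite exchange_big /=; apply: eq_bigr => x _.
    under eq_bigr do rewrite exchange_big /=.
    rewrite exchange_big /=; apply: eq_bigr => y _.
    rewrite mulr_sumr; apply: eq_bigr => o _.
    rewrite -mulr_sumr; congr (_ * _).
    rewrite (sum_prod_Idx (fun i c => lcp (K o i) (delta_mx (x i) (y i)) c c)).
    by apply: eq_bigr => i _; apply: sum_lcp_diag.
  apply: eq_bigr => x _; apply: eq_bigr => y _; congr (_ * _).
  have -> : \sum_o \prod_i kraus_sum (K o i) (y i) (x i) =
      \sum_o kraus_sum (K o j) (y j) (x j) * \prod_(i | i != j) (x i == y i)%:R.
    apply: eq_bigr => o _; rewrite (bigD1 j) //=; congr (_ * _).
    apply: eq_bigr => i ij; by rewrite K1 // mxE [in LHS]eq_sym.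
  rewrite -mulr_suml -summxE Kj mxE [in LHS]eq_sym -eq_Idx -prod_bool_natr [RHS](bigD1 j) //=.
- rewrite -IH1 -(pair_big predT predT (fun o1 o2 => tr (I2 o1 o2 (I1 o1 A)))) /=.
  by apply: eq_bigr => o1 _; apply: IH2.
- rewrite -IH [RHS](partition_big g predT) //=; apply: eq_bigr => o' _.
  by rewrite /tr exchange_big.
Qed.

Lemma LOCC_state d e (L : kOp d -> kOp e) A : LOCCchannel L -> is_state A -> is_state (L A).
Proof.
move=> HL [pA tA]; split; first exact: (LOCC_psd HL tt).
by rewrite -tA -(LOCC_trace HL A) (big_pred1 tt) // => -[].
Qed.

Lemma LOCC_tracedist d e (L : kOp d -> kOp e) t A B : LOCCchannel L ->
  tracedist_le t A B -> tracedist_le t (L A) (L B).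
Proof.
move=> HL [P [Q [pP pQ E tPQ]]]; exists (L P), (L Q).
have trL D : tr (L D) = tr D by rewrite -(LOCC_trace HL D) (big_pred1 tt) // => -[].
split; try exact: (LOCC_psd HL tt).
  move=> x y.
  (* Linearity is available for sums, so $A-B=P-Q$ is used in the form $A+Q=P+B$. *)
  have lin := LOCC_linear HL tt 1.
  have := congr1 (fun D : kOp e => D x y) (lin A Q); have := congr1 (fun D : kOp e => D x y) (lin P B).
  have -> : (fun u v => 1 * A u v + Q u v) = (fun u v => 1 * P u v + B u v).
    apply: funext => u; apply: funext => v; rewrite !mul1r.
    by rewrite -[A u v](subrK (B u v)) E; ring.
  move=> -> /=; rewrite !mul1r => h.
  by rewrite -[L A x y](addrK (L Q x y)) -h; ring.
by rewrite !trL.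
Qed.

End LOCCProperties.

Lemma LOCC_ext k (d e : 'I_k -> nat) (O : finType) (I J : O -> kOp d -> kOp e) :
  LOCCinstr I -> (forall o A, I o A = J o A) -> LOCCinstr J.
Proof.
move=> HI IJ; suff <- : I = J by [].
by apply: funext => o; apply: funext => A.
Qed.

Lemma LOCC_comp k (d m e : 'I_k -> nat) (L1 : kOp d -> kOp m) (L2 : kOp m -> kOp e) :
  LOCCchannel L1 -> LOCCchannel L2 -> LOCCchannel (fun A => L2 (L1 A)).
Proof.
move=> H1 H2; have := LOCC_coarse (fun _ => tt) (LOCC_seq H1 (fun _ => H2)).
move=> H; apply: LOCC_ext H _ => -[] A; apply: funext => a; apply: funext => b.
by rewrite (big_pred1 (tt, tt)) // => -[[] []].
Qed.

Lemma LOCC_adaptive k (d m e : 'I_k -> nat) (O : finType) (I : O -> kOp d -> kOp m)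
    (L : O -> kOp m -> kOp e) :
  LOCCinstr I -> (forall o, LOCCchannel (L o)) ->
  LOCCchannel (fun A => fun a b => \sum_o L o (I o A) a b).
Proof.
move=> HI HL; have := LOCC_coarse (fun _ => tt) (LOCC_seq HI HL).
move=> H; apply: LOCC_ext H _ => -[] A; apply: funext => a; apply: funext => b.
rewrite (reindex (fun o => (o, tt))) /=; first exact: eq_bigl.
by exists fst => // -[o []].
Qed.

(** * Local channels, discarding a subsystem, and spectator systems *)

Section Local.
Variable k : nat.
Hypothesis hk : (0 < k)%N.
Implicit Types d e f : 'I_k -> nat.

Lemma LOCC_local d e (K : forall i, seq 'M[C]_(e i, d i)) :
  (forall i, kraus_sum (K i) = 1%:M) -> LOCCchannel (prodmap (fun i => lcp (K i))).
Proof.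
move=> K1; apply: (@LOCC_round k d e unit (Ordinal hk) (fun _ => K)) => //.
by rewrite (big_pred1 tt) ?K1 // => -[].
Qed.

Definition mkI d (g : forall i, 'I_(d i)) : Idx d := @finfun _ (fun i => 'I_(d i)) g.

Lemma mkIE d (g : forall i, 'I_(d i)) i : mkI g i = g i.
Proof. exact: ffunE. Qed.

Definition mapI d e (F : forall i, 'I_(d i) -> 'I_(e i)) (x : Idx d) : Idx e :=
  mkI (fun i => F i (x i)).

Lemma LOCC_relabel d e (F : forall i, 'I_(d i) -> 'I_(e i)) (G : forall i, 'I_(e i) -> 'I_(d i)) :
  (forall i, cancel (F i) (G i)) -> (forall i, cancel (G i) (F i)) ->
  LOCCchannel (fun A : kOp d => fun a b => A (mapI G a) (mapI G b)).
Proof.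
move=> FK GK; pose K i : seq 'M[C]_(e i, d i) := [:: \matrix_(a, x) (a == F i x)%:R].
have lK i p q a b : lcp (K i) (delta_mx p q) a b = (a == F i p)%:R * (b == F i q)%:R.
  by rewrite lcp_delta big_seq1 !mxE; case: (b == _); rewrite ?rmorph1 ?rmorph0.
have K1 i : kraus_sum (K i) = 1%:M.
  apply/matrixP => p q; rewrite -sum_lcp_diag (bigD1 (F i p)) //= big1 ?addr0; last first.
    by move=> a /negPf ap; rewrite lK ap mulr0.
  by rewrite lK !mxE eqxx mulr1 (can_eq (FK i)); case: eqP.
apply: (LOCC_ext (LOCC_local K1)) => -[] A; apply: funext => a; apply: funext => b.
rewrite /prodmap (bigD1 (mapI G a)) //= [X in _ + X]big1 ?addr0; last first.
  move=> x xa; rewrite big1 // => y _.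
  suff /existsP[i xi] : [exists i, x i != G i (a i)].
    rewrite (bigD1 i) //= lK.
    have -> : (a i == F i (x i)) = false; last by rewrite !mul0r mulr0.
    by apply/eqP => E; case/eqP: xi; rewrite E FK.
  rewrite -negb_forall; apply: contra xa => /forallP H; apply/eqP/ffunP => i.
  by rewrite mkIE (eqP (H i)).
rewrite (bigD1 (mapI G b)) //= [X in _ + X]big1 ?addr0; last first.
  move=> y yb.
  suff /existsP[i yi] : [exists i, y i != G i (b i)].
    rewrite (bigD1 i) //= lK.
    have -> : (b i == F i (y i)) = false; last by rewrite mulr0 mul0r mulr0.
    by apply/eqP => E; case/eqP: yi; rewrite E FK.
  rewrite -negb_forall; apply: contra yb => /forallP H; apply/eqP/ffunP => i.
  by rewrite mkIE (eqP (H i)).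
rewrite big1 ?mulr1 // => i _.
by rewrite lK !mkIE !GK !eqxx mulr1.
Qed.

Definition fstI d e (x : Idx (fun i => d i * e i)%N) : Idx d :=
  mkI (fun i => (mxtens_unindex (x i)).1).
Definition sndI d e (x : Idx (fun i => d i * e i)%N) : Idx e :=
  mkI (fun i => (mxtens_unindex (x i)).2).
Definition pairI d e (u : Idx d) (v : Idx e) : Idx (fun i => d i * e i)%N :=
  mkI (fun i => mxtens_index (u i, v i)).

Lemma tensE d e (A : kOp d) (B : kOp e) x y :
  tens A B x y = A (fstI x) (fstI y) * B (sndI x) (sndI y).
Proof. by []. Qed.

Lemma fst_pairI d e (u : Idx d) (v : Idx e) : fstI (pairI u v) = u.
Proof. by apply/ffunP => i; rewrite !mkIE mxtens_indexK. Qed.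

Lemma snd_pairI d e (u : Idx d) (v : Idx e) : sndI (pairI u v) = v.
Proof. by apply/ffunP => i; rewrite !mkIE mxtens_indexK. Qed.

Lemma pairI_fst_snd d e (x : Idx (fun i => d i * e i)%N) : pairI (fstI x) (sndI x) = x.
Proof. by apply/ffunP => i; rewrite !mkIE -surjective_pairing mxtens_unindexK. Qed.

Lemma sum_pairI d e (F : Idx (fun i => d i * e i)%N -> C) :
  \sum_x F x = \sum_u \sum_v F (pairI u v).
Proof.
rewrite pair_big /= (reindex (fun p : Idx d * Idx e => pairI p.1 p.2)) //=.
exists (fun x => (fstI x, sndI x)) => [[u v] _ | x _] /=.
  by rewrite fst_pairI snd_pairI.
exact: pairI_fst_snd.
Qed.

Lemma tr_tens d e (A : kOp d) (B : kOp e) : tr (tens A B) = tr A * tr B.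
Proof.
rewrite /tr sum_pairI mulr_suml; apply: eq_bigr => u _; rewrite mulr_sumr.
by apply: eq_bigr => v _; rewrite tensE fst_pairI snd_pairI.
Qed.

Lemma psd_gram (T : finType) (A : Op T) : psd A ->
  exists S : Op T, forall x y, A x y = \sum_z S x z * (S y z)^*.
Proof.
move=> pA; have [pS SS] := sqrtmP pA; exists (sqrtm A) => x y.
rewrite -[in LHS]SS; apply: eq_bigr => z _; congr (_ * _).
have := psdmx_herm (proj1 (psd_mxop _) pS) => /matrixP/(_ (enum_rank z) (enum_rank y)).
by rewrite !mxE !enum_rankK => ->.
Qed.

(** Factoring only $B=SS^*$ writes the tensor product as a sum of congruences of [A] by the maps
    $u\mapsto u\otimes S_z$, with $S_z$ the columns of [S]. *)
Lemma psd_tens d e (A : kOp d) (B : kOp e) : psd A -> psd B -> psd (tens A B).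
Proof.
move=> pA /psd_gram[S BS].
have -> : tens A B = fun a b => \sum_z \sum_x \sum_y A x y *
    (((x == fstI a)%:R * S (sndI a) z) * ((y == fstI b)%:R * S (sndI b) z)^*).
  apply: funext => a; apply: funext => b; rewrite tensE BS mulr_sumr.
  apply: eq_bigr => z _; rewrite (bigD1 (fstI a)) //= [X in _ + X]big1 ?addr0; last first.
    by move=> x /negPf xa; rewrite big1 // => y _; rewrite xa !mul0r mulr0.
  rewrite (bigD1 (fstI b)) //= [X in _ + X]big1 ?addr0; last first.
    by move=> y /negPf yb; rewrite yb mul0r rmorph0 !mulr0.
  by rewrite !eqxx !mul1r.
apply: psd_sum => z _.
exact: (psd_congr (fun a x => (x == fstI a)%:R * S (sndI a) z) pA).
Qed.

Lemma state_tens d e (A : kOp d) (B : kOp e) :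
  is_state A -> is_state B -> is_state (tens A B).
Proof.
move=> [pA tA] [pB tB]; split; first exact: psd_tens.
by rewrite tr_tens tA tB mulr1.
Qed.

Lemma psd_rank1 (T : finType) (w : T -> C) : psd (fun x y => w x * (w y)^*).
Proof.
move=> v; have := mul_conjC_ge0 (\sum_x (v x)^* * w x).
rewrite rmorph_sum mulr_suml; congr (0 <= _); apply: eq_bigr => x _.
rewrite mulr_sumr; apply: eq_bigr => y _; rewrite rmorphM /= conjCK; ring.
Qed.

Lemma state_trivial : is_state (fun _ _ : Idx (fun _ : 'I_k => 1%N) => 1).
Proof.
split=> [v|].
  have := psd_rank1 (fun _ : Idx (fun _ : 'I_k => 1%N) => 1) v.
  by congr (0 <= _); apply: eq_bigr => x _; apply: eq_bigr => y _; rewrite rmorph1 mulr1.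
have := @sum_prod_Idx k (fun _ => 1%N) (fun _ _ => 1).
rewrite [RHS]big1; last by move=> i _; rewrite big_ord_recl big_ord0 addr0.
by move=> E; rewrite -[RHS]E; apply: eq_bigr => x _; rewrite big1.
Qed.

Lemma state_tpow d (A : kOp d) n : is_state A -> is_state (tpow A n).
Proof.
move=> sA; elim: n => [|n IH]; [exact: state_trivial | exact: state_tens].
Qed.

Lemma sum_mxtens_index m n (F : 'I_(m * n) -> C) :
  \sum_z F z = \sum_a \sum_v F (mxtens_index (a, v)).
Proof.
rewrite (reindex (@mxtens_index m n)); last first.
  by exists (@mxtens_unindex m n) => z _; rewrite ?mxtens_indexK ?mxtens_unindexK.
by rewrite pair_big; apply: eq_bigr => -[a c] _.
Qed.

(** Every party traces out its second factor, with Kraus operators $1\otimes\langle v|$. *)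
Lemma LOCC_discard d e : exists2 L : kOp (fun i => d i * e i)%N -> kOp d,
  LOCCchannel L & forall (A : kOp d) (B : kOp e), tr B = 1 -> L (tens A B) = A.
Proof.
pose K i : seq 'M[C]_(d i, d i * e i) :=
  [seq \matrix_(u, w) (w == mxtens_index (u, v))%:R | v <- enum 'I_(e i)].
have sK i a b p q : lcp (K i) (delta_mx p q) a b =
    \sum_(v < e i) (p == mxtens_index (a, v))%:R * (q == mxtens_index (b, v))%:R.
  rewrite lcp_delta big_map big_enum; apply: eq_bigr => v _.
  by rewrite !mxE; case: (q == _); rewrite ?rmorph1 ?rmorph0.
have K1 i : kraus_sum (K i) = 1%:M.
  apply/matrixP => p q; rewrite -sum_lcp_diag.
  transitivity (\sum_a \sum_v (q == mxtens_index (a, v))%:R * (p == mxtens_index (a, v))%:R : C).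
    by apply: eq_bigr => a _; rewrite sK.
  rewrite -(sum_mxtens_index (fun z => (q == z)%:R * (p == z)%:R)).
  rewrite (bigD1 p) //= [X in _ + X]big1 ?addr0; last first.
    by move=> z /negPf zp; rewrite [p == z]eq_sym zp mulr0.
  by rewrite eqxx mulr1 mxE eq_sym.
exists (prodmap (fun i => lcp (K i))); first exact: LOCC_local.
move=> A B tB; apply: funext => a; apply: funext => b; rewrite /prodmap.
transitivity (\sum_x \sum_y tens A B x y *
    \sum_(v : Idx e) (x == pairI a v)%:R * (y == pairI b v)%:R).
  apply: eq_bigr => x _; apply: eq_bigr => y _; congr (_ * _).
  under eq_bigr do rewrite sK.
  rewrite -(@sum_prod_Idx k e (fun i v => (x i == mxtens_index (a i, v))%:R *
    (y i == mxtens_index (b i, v))%:R)); apply: eq_bigr => v _.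
  rewrite big_split /= -!eq_Idx -!prod_bool_natr; congr (_ * _);
    by apply: eq_bigr => i _; rewrite mkIE.
transitivity (\sum_(v : Idx e) A a b * B v v).
  under eq_bigr do under eq_bigr do rewrite mulr_sumr.
  under eq_bigr do rewrite exchange_big.
  rewrite exchange_big /=; apply: eq_bigr => v _.
  rewrite (bigD1 (pairI a v)) //= [X in _ + X]big1 ?addr0; last first.
    by move=> x /negPf xa; rewrite big1 // => y _; rewrite xa mul0r mulr0.
  rewrite (bigD1 (pairI b v)) //= [X in _ + X]big1 ?addr0; last first.
    by move=> y /negPf yb; rewrite yb !mulr0.
  by rewrite !eqxx !mulr1 tensE !fst_pairI !snd_pairI.
by rewrite -mulr_sumr -/(tr B) tB mulr1.
Qed.

Definition kraus_tens1 (p m n : nat) (Ks : seq 'M[C]_(n, m)) : seq 'M[C]_(n * p, m * p) :=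
  [seq X *t (1%:M : 'M[C]_p) | X <- Ks].

Lemma lcp_tens1 p m n (Ks : seq 'M[C]_(n, m)) (x y : 'I_(m * p)) (a b : 'I_(n * p)) :
  lcp (kraus_tens1 p Ks) (delta_mx x y) a b =
      lcp Ks (delta_mx (mxtens_unindex x).1 (mxtens_unindex y).1)
        (mxtens_unindex a).1 (mxtens_unindex b).1 *
      ((mxtens_unindex a).2 == (mxtens_unindex x).2)%:R *
      ((mxtens_unindex b).2 == (mxtens_unindex y).2)%:R.
Proof.
rewrite !lcp_delta big_map !mulr_suml; apply: eq_bigr => X _.
rewrite !mxE rmorphM.
by do 2 case: (_ == _); rewrite ?mulr1n ?mulr0n ?rmorph1 ?rmorph0; ring.
Qed.

Lemma kraus_sum_tens1 p m n (Ks : seq 'M[C]_(n, m)) :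
  kraus_sum (kraus_tens1 p Ks) = kraus_sum Ks *t (1%:M : 'M[C]_p).
Proof.
apply/matrixP => x y; rewrite -sum_lcp_diag mxE -sum_lcp_diag.
rewrite sum_mxtens_index mulr_suml; apply: eq_bigr => a _.
have E c : lcp (kraus_tens1 p Ks) (delta_mx y x) (mxtens_index (a, c)) (mxtens_index (a, c)) =
    lcp Ks (delta_mx (mxtens_unindex y).1 (mxtens_unindex x).1) a a *
    (c == (mxtens_unindex y).2)%:R * (c == (mxtens_unindex x).2)%:R.
  by rewrite lcp_tens1 !mxtens_indexK.
rewrite (bigD1 (mxtens_unindex x).2) // E [X in X + _ = _]/= eqxx mulr1.
rewrite big1 ?addr0; last by move=> c /negPf xc; rewrite E xc mulr0.
by rewrite [in RHS]mxE.
Qed.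

Lemma tens1_mx1 m p : (1%:M : 'M[C]_m) *t (1%:M : 'M[C]_p) = 1%:M.
Proof.
apply/matrixP => x y; rewrite !mxE -natrM mulnb; congr (_%:R).
congr nat_of_bool; apply/idP/idP => [/andP[/eqP h1 /eqP h2]|/eqP -> //]; last first.
  by rewrite !eqxx.
apply/eqP.
by rewrite -(mxtens_unindexK x) -(mxtens_unindexK y) [mxtens_unindex x]surjective_pairing
  [mxtens_unindex y]surjective_pairing h1 h2.
Qed.

(** An instrument is a bare function, so its extension to a spectator has to be rebuilt along the
    derivation of [LOCCinstr]; in the adaptive case this selects an extension for each earlier
    outcome. Specifying it on product operators is enough for adjoining a spectator state. *)
Lemma LOCC_tens d e (O : finType) (I : O -> kOp d -> kOp e) : LOCCinstr I ->
  forall f, exists2 J : O -> kOp (fun i => d i * f i)%N -> kOp (fun i => e i * f i)%N,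
    LOCCinstr J & forall o A (B : kOp f), J o (tens A B) = tens (I o A) B.
Proof.
elim=> {d e O I} [d e O j K Kc K1 Kj|d m e O1 O2 I1 I2 _ IH1 _ IH2|d e O O' g I _ IH] f.
- exists (fun o => prodmap (fun i => lcp (kraus_tens1 (f i) (K o i)))).
    apply: (LOCC_round (j := j) (K := fun o i => kraus_tens1 (f i) (K o i))).
    + by move=> i ij o o'; rewrite (Kc i ij o o').
    + by move=> i ij o; rewrite kraus_sum_tens1 K1 // tens1_mx1.
    + under eq_bigr do rewrite kraus_sum_tens1.
      rewrite (_ : \sum_o _ = (\sum_o kraus_sum (K o j)) *t (1%:M : 'M[C]_(f j))); last first.
        by apply/matrixP => x y; rewrite summxE !mxE summxE mulr_suml; apply: eq_bigr => o _; rewrite !mxE.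
      by rewrite Kj tens1_mx1.
  move=> o A B; apply: funext => a; apply: funext => b.
  rewrite tensE /prodmap sum_pairI mulr_suml; apply: eq_bigr => u _.
  transitivity (\sum_v \sum_(u' : Idx d) \sum_(v' : Idx f) A u u' * B v v' *
      (\prod_i lcp (K o i) (delta_mx (u i) (u' i)) (fstI a i) (fstI b i)) *
      (sndI a == v)%:R * (sndI b == v')%:R).
    apply: eq_bigr => v _; rewrite sum_pairI; apply: eq_bigr => u' _; apply: eq_bigr => v' _.
    rewrite tensE !fst_pairI !snd_pairI -!mulrA; congr (_ * (_ * _)).
    rewrite -!eq_Idx -!prod_bool_natr -!big_split /=; apply: eq_bigr => i _.
    by rewrite lcp_tens1 !mkIE !mxtens_indexK mulrA.
  rewrite (bigD1 (sndI a)) //= [X in _ + X]big1 ?addr0; last first.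
    move=> v /negPf va; rewrite big1 // => u' _; rewrite big1 // => v' _.
    by rewrite eq_sym va mulr0 mul0r.
  rewrite mulr_suml; apply: eq_bigr => u' _.
  rewrite (bigD1 (sndI b)) //= [X in _ + X]big1 ?addr0; last first.
    by move=> v' /negPf vb; rewrite [_ == v']eq_sym vb mulr0.
  by rewrite !eqxx !mulr1 mulrAC.
- have [J1 HJ1 E1] := IH1 f.
  have /choice[J2 HJ2] : forall o1, exists J : O2 ->
      kOp (fun i => m i * f i)%N -> kOp (fun i => e i * f i)%N, LOCCinstr J /\
      forall o A (B : kOp f), J o (tens A B) = tens (I2 o1 o A) B.
    by move=> o1; have [J HJ E] := IH2 o1 f; exists J.
  exists (fun o : O1 * O2 => fun A => J2 o.1 o.2 (J1 o.1 A)).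
    exact: (LOCC_seq HJ1 (fun o1 => proj1 (HJ2 o1))).
  by move=> [o1 o2] A B /=; rewrite E1; case: (HJ2 o1) => _ ->.
- have [J HJ E] := IH f.
  exists (fun o' A => fun a b => \sum_(o | g o == o') J o A a b); first exact: (LOCC_coarse g HJ).
  move=> o A B; apply: funext => a; apply: funext => b; rewrite tensE mulr_suml.
  by apply: eq_bigr => o' _; rewrite E.
Qed.

End Local.

(** * The monoid of states *)

Section StateMonoid.
Variable k : nat.
Hypothesis hk : (0 < k)%N.

Record state := State { sdim : 'I_k -> nat; sop : kOp sdim; sopP : is_state sop }.
Arguments sop : clear implicits.

Definition stens (x y : state) : state := State (state_tens (sopP x) (sopP y)).

Definition spow (x : state) (n : nat) : state := State (state_tpow n (sopP x)).

Definition sone : state := State (state_trivial k).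

Lemma state_eq (d : 'I_k -> nat) (A : kOp d) (p q : is_state A) : State p = State q.
Proof. by rewrite (Prop_irrelevance p q). Qed.

Lemma spowE x n : spow x n = pw stens sone x n.
Proof.
elim: n => [|n IH]; first exact: state_eq.
rewrite /= -IH; exact: state_eq.
Qed.

Definition local_iso (x y : state) : Prop :=
  exists (F : forall i, 'I_(sdim y i) -> 'I_(sdim x i)) (G : forall i, 'I_(sdim x i) -> 'I_(sdim y i)),
  [/\ forall i, cancel (F i) (G i), forall i, cancel (G i) (F i) &
      forall a b, sop y a b = sop x (mapI F a) (mapI F b)].

Lemma local_isoW (x y : state) (F : forall i, 'I_(sdim y i) -> 'I_(sdim x i)) :
  (forall i, exists G, cancel (F i) G /\ cancel G (F i)) ->
  (forall a b, sop y a b = sop x (mapI F a) (mapI F b)) -> local_iso x y.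
Proof.
move=> FG E.
exists F, (fun i => projT1 (cid (FG i))); split => // i.
  by case: (projT2 (cid (FG i))).
by case: (projT2 (cid (FG i))).
Qed.

Let idx1 m n (a : 'I_m) (b : 'I_n) : (mxtens_unindex (mxtens_index (a, b))).1 = a.
Proof. by rewrite mxtens_indexK. Qed.
Let idx2 m n (a : 'I_m) (b : 'I_n) : (mxtens_unindex (mxtens_index (a, b))).2 = b.
Proof. by rewrite mxtens_indexK. Qed.
Let idxK m n (c : 'I_(m * n)) : mxtens_index ((mxtens_unindex c).1, (mxtens_unindex c).2) = c.
Proof. by rewrite -surjective_pairing mxtens_unindexK. Qed.

Lemma state_monoid : cmonoid_upto stens sone local_iso.
Proof.
have mapE (d e : 'I_k -> nat) (F : forall i, 'I_(d i) -> 'I_(e i)) x i : mapI F x i = F i (x i).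
  exact: mkIE.
split.
- move=> x; exists (fun i => id), (fun i => id); split=> // a b.
  by congr (sop x _ _); apply/ffunP => i; rewrite mapE.
- move=> x y [F [G [FK GK E]]]; exists G, F; split => // a b.
  by rewrite E; congr (sop x _ _); apply/ffunP => i; rewrite !mapE GK.
- move=> y x z [F [G [FK GK E]]] [F' [G' [FK' GK' E']]].
  exists (fun i => F i \o F' i), (fun i => G' i \o G i); split => [i|i|a b].
  + exact: can_comp.
  + exact: can_comp.
  + rewrite E' E; congr (sop x _ _); apply/ffunP => i; rewrite !mapE //.
- move=> x x' y y' [F [G [FK GK E]]] [F' [G' [FK' GK' E']]].
  apply: (local_isoW (x := stens x y) (y := stens x' y') (F := fun i c =>
    mxtens_index (F i (mxtens_unindex c).1, F' i (mxtens_unindex c).2))).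
    move=> i; exists (fun c => mxtens_index (G i (mxtens_unindex c).1, G' i (mxtens_unindex c).2)).
    by split=> c; cbv beta; rewrite !(idx1, idx2) ?(FK, FK', GK, GK') idxK.
  move=> a b; rewrite [LHS]tensE ?tensE [RHS]tensE ?tensE E E'.
  by congr (sop x _ _ * sop y _ _); apply/ffunP => i; rewrite !(mapE, mkIE, idx1, idx2).
- move=> x y z; apply: (local_isoW (x := stens x (stens y z)) (y := stens (stens x y) z)
    (F := fun i c => let: p := mxtens_unindex c in let: q := mxtens_unindex p.1 in
      mxtens_index (q.1, mxtens_index (q.2, p.2)))).
    move=> i; exists (fun c => let: p := mxtens_unindex c in let: q := mxtens_unindex p.2 in
      mxtens_index (mxtens_index (p.1, q.1), q.2)).
    by split=> c; cbv beta zeta; rewrite !(idx1, idx2) !idxK.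
  move=> a b; rewrite [LHS]tensE ?tensE [RHS]tensE ?tensE mulrA.
  by congr (sop x _ _ * sop y _ _ * sop z _ _); apply/ffunP => i;
    rewrite !(mapE, mkIE, idx1, idx2).
- move=> x y; apply: (local_isoW (x := stens x y) (y := stens y x)
    (F := fun i c => let: p := mxtens_unindex c in mxtens_index (p.2, p.1))).
    move=> i; exists (fun c => let: p := mxtens_unindex c in mxtens_index (p.2, p.1)).
    by split=> c; cbv beta zeta; rewrite !(idx1, idx2) idxK.
  move=> a b; rewrite [LHS]tensE ?tensE [RHS]tensE ?tensE mulrC.
  by congr (sop x _ _ * sop y _ _); apply/ffunP => i; rewrite !(mapE, mkIE, idx1, idx2).
- move=> x; apply: (local_isoW (x := stens sone x) (y := x)
    (F := fun i c => mxtens_index (ord0 : 'I_1, c))).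
    move=> i; exists (fun c => (mxtens_unindex c).2).
    split=> c; cbv beta; first by rewrite idx2.
    by rewrite -[RHS]idxK; congr (mxtens_index (_, _)); rewrite [RHS]ord1.
  move=> a b; rewrite [RHS]tensE mul1r.
  by congr (sop x _ _); apply/ffunP => i; rewrite !(mapE, mkIE, idx1, idx2).
Qed.

Definition convertible (t : Rr) (x y : state) : Prop :=
  exists2 L : kOp (sdim x) -> kOp (sdim y),
    LOCCchannel L & tracedist_le t (L (sop x)) (sop y).

Lemma convertible0 x y (L : kOp (sdim x) -> kOp (sdim y)) :
  LOCCchannel L -> L (sop x) = sop y -> convertible 0 x y.
Proof. by move=> HL E; exists L => //; rewrite E; apply: tracedist_refl. Qed.

Lemma convertible_sim x y : local_iso x y -> convertible 0 x y.
Proof.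
move=> [F [G [FK GK E]]]; apply: (convertible0 (LOCC_relabel hk GK FK)).
by apply: funext => a; apply: funext => b; rewrite E.
Qed.

Lemma convertible_trans s t x y z :
  convertible s x y -> convertible t y z -> convertible (s + t) x z.
Proof.
move=> [L1 H1 E1] [L2 H2 E2]; exists (fun A => L2 (L1 A)); first exact: LOCC_comp.
by apply: tracedist_trans E2; apply: LOCC_tracedist.
Qed.

Lemma tracedist_tens (d e : 'I_k -> nat) t (A B : kOp d) (D : kOp e) : is_state D ->
  tracedist_le t A B -> tracedist_le t (tens A D) (tens B D).
Proof.
move=> [pD tD] [P [Q [pP pQ E tPQ]]]; exists (tens P D), (tens Q D).
split; try exact: psd_tens.
  by move=> x y; rewrite !tensE -!mulrBl E.
by rewrite !tr_tens tD !mulr1.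
Qed.

Lemma convertible_opr t x y z : convertible t x y -> convertible t (stens x z) (stens y z).
Proof.
move=> [L HL E]; have [J HJ EJ] := LOCC_tens HL (sdim z).
exists (J tt); first by apply: LOCC_ext HJ _ => -[].
by rewrite EJ; apply: tracedist_tens => //; apply: sopP.
Qed.

Lemma convertible_le s t x y : s <= t -> convertible s x y -> convertible t x y.
Proof. by move=> st [L HL E]; exists L => //; apply: tracedist_le_mono st E. Qed.

Lemma convertible_drop x y : convertible 0 (stens x y) x.
Proof.
have [L HL E] := LOCC_discard hk (sdim x) (sdim y).
by apply: (@convertible0 (stens x y) x L HL); apply: E; case: (sopP y).
Qed.

End StateMonoid.
Arguments sop {k} s.

(** * Preparing an arbitrary state from GHZ states *)

Section KernelStates.
Variable k : nat.
Hypothesis hk : (0 < k)%N.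
Implicit Types d e : 'I_k -> nat.

(* sum_{z,w} phi(z,w) |X z><X w| *)
Definition kst (Z : finType) e (X : Z -> Idx e) (phi : Z -> Z -> C) : kOp e :=
  fun a b => \sum_z \sum_w phi z w * ((a == X z)%:R * (b == X w)%:R).

(** The local maps of the preparation protocol act on the relevant matrix units by a scalar and a
    relabelling, so only the kernel and the index map change. Asking for this only on the support of
    [phi] leaves freedom on levels that encode nothing. *)
Lemma prodmap_kst (Z : finType) d e (Phi : forall i, 'M[C]_(d i) -> 'M[C]_(e i))
    (X : Z -> Idx d) (Y : Z -> Idx e) (phi : Z -> Z -> C) (c : 'I_k -> Z -> Z -> C) :
  (forall z w, phi z w != 0 -> forall i,
    Phi i (delta_mx (X z i) (X w i)) = c i z w *: delta_mx (Y z i) (Y w i)) ->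
  prodmap Phi (kst X phi) = kst Y (fun z w => phi z w * \prod_i c i z w).
Proof.
move=> H; apply: funext => a; apply: funext => b; rewrite /prodmap /kst.
transitivity (\sum_x \sum_y \sum_z \sum_w phi z w * ((x == X z)%:R * (y == X w)%:R) *
    \prod_i Phi i (delta_mx (x i) (y i)) (a i) (b i)).
  apply: eq_bigr => x _; apply: eq_bigr => y _; rewrite mulr_suml.
  by apply: eq_bigr => z _; rewrite mulr_suml.
under eq_bigr do rewrite exchange_big /=.
rewrite exchange_big /=; apply: eq_bigr => z _.
under eq_bigr do rewrite exchange_big /=.
rewrite exchange_big /=; apply: eq_bigr => w _.
rewrite (bigD1 (X z)) //= [X in _ + X]big1 ?addr0; last first.
  by move=> x /negPf xz; rewrite big1 // => y _; rewrite xz !(mul0r, mulr0).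
rewrite (bigD1 (X w)) //= [X in _ + X]big1 ?addr0; last first.
  by move=> y /negPf yw; rewrite yw !(mul0r, mulr0).
rewrite !eqxx !mulr1; have [->|p0] := eqVneq (phi z w) 0; first by rewrite !mul0r.
rewrite -mulrA; congr (_ * _).
rewrite -!eq_Idx -!prod_bool_natr -!big_split /=; apply: eq_bigr => i _.
by rewrite H // !mxE -natrM mulnb.
Qed.

Lemma eq_kst (Z : finType) e (X Y : Z -> Idx e) (phi psi : Z -> Z -> C) :
  (forall z, X z = Y z) -> (forall z w, phi z w = psi z w) -> kst X phi = kst Y psi.
Proof.
move=> XY pp; apply: funext => a; apply: funext => b.
by apply: eq_bigr => z _; apply: eq_bigr => w _; rewrite pp !XY.
Qed.

Definition monomial m n (c : 'I_m -> C) (h : 'I_m -> 'I_n) : 'M[C]_(n, m) :=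
  \matrix_(a, p) (c p * (a == h p)%:R).

Lemma lcp_monomial m n (I : Type) (r : seq I) (c : I -> 'I_m -> C) (h : 'I_m -> 'I_n) p q :
  lcp [seq monomial (c l) h | l <- r] (delta_mx p q) =
  (\sum_(l <- r) c l p * (c l q)^*) *: delta_mx (h p) (h q).
Proof.
apply/matrixP => a b; rewrite lcp_delta big_map !mxE mulr_suml.
apply: eq_bigr => l _; rewrite !mxE rmorphM -mulnb natrM.
by case: (b == _); rewrite ?rmorph1 ?rmorph0; ring.
Qed.

Lemma kraus_sum_monomial m n (I : Type) (r : seq I) (c : I -> 'I_m -> C) (h : 'I_m -> 'I_n) p q :
  kraus_sum [seq monomial (c l) h | l <- r] p q =
  (\sum_(l <- r) (c l p)^* * c l q) * (h p == h q)%:R.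
Proof.
rewrite -sum_lcp_diag.
under eq_bigr do rewrite lcp_monomial !mxE.
rewrite (bigD1 (h p)) //= [X in _ + X]big1 ?addr0; last first.
  by move=> a /negPf ap; rewrite ap andbF mulr0.
by rewrite eqxx andbT; congr (_ * _); apply: eq_bigr => l _; rewrite mulrC.
Qed.

Lemma kraus_sum_id n : kraus_sum [:: (1%:M : 'M[C]_n)] = 1%:M.
Proof. by rewrite /kraus_sum big_seq1 /adjmx trmx1 map_mx1 mulmx1. Qed.

Lemma lcp_id n (A : 'M[C]_n) : lcp [:: 1%:M] A = A.
Proof. by rewrite /lcp big_seq1 /adjmx trmx1 map_mx1 mulmx1 mul1mx. Qed.

Let i0 : 'I_k := Ordinal hk.

Definition constI D (z : 'I_D) : Idx (fun _ : 'I_k => D) := @mkI k (fun _ => D) (fun _ => z).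

Definition is_const D (a : Idx (fun _ : 'I_k => D)) := [forall i, a i == a i0].

Lemma eq_constI D (a : Idx (fun _ : 'I_k => D)) z : (a == constI z) = is_const a && (a i0 == z).
Proof.
apply/eqP/andP => [->|[/forallP ca /eqP az]].
  by split; [apply/forallP => i|]; rewrite !mkIE.
by apply/ffunP => i; rewrite mkIE -az; apply/eqP.
Qed.

Lemma sum_eq_constI D (a : Idx (fun _ : 'I_k => D)) :
  \sum_z (a == constI z)%:R = (is_const a)%:R :> C.
Proof.
rewrite (bigD1 (a i0)) //= big1 ?addr0 ?eq_constI ?eqxx ?andbT //.
by move=> z /negPf za; rewrite eq_constI eq_sym za andbF.
Qed.

Lemma GHZ_const (a b : Idx (fun _ : 'I_k => 2)) :
  GHZ k a b = 2^-1 * ((is_const a)%:R * (is_const b)%:R).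
Proof.
have E (x : Idx (fun _ : 'I_k => 2)) : ghz_supp x = is_const x.
  apply/orP/forallP => [[/forallP H|/forallP H] i|H].
  - by rewrite -val_eqE /= (eqP (H i)) (eqP (H i0)).
  - by rewrite -val_eqE /= (eqP (H i)) (eqP (H i0)).
  - have := ltn_ord (x i0).
    case E : (nat_of_ord (x i0)) => [|[|//]] _; [left|right]; apply/forallP => i;
      by rewrite (eqP (H i)); apply/eqP.
by rewrite /GHZ !E; do 2 case: is_const; rewrite ?mulr1 ?mulr0 ?mul0r.
Qed.

Lemma tpow_GHZ_const n (a b : Idx (fun _ : 'I_k => pdim 2 n)) :
  tpow (GHZ k) n a b = (pdim 2 n)%:R^-1 * ((is_const a)%:R * (is_const b)%:R).
Proof.
elim: n a b => [|n IH] a b.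
  rewrite /= invr1 mul1r.
  have E (x : Idx (fun _ : 'I_k => 1%N)) : is_const x.
    by apply/forallP => i; rewrite (ord1 (x i)) (ord1 (x i0)).
  by rewrite !E mulr1.
pose fs := @fstI k (fun _ => 2) (fun _ => pdim 2 n).
pose sn := @sndI k (fun _ => 2) (fun _ => pdim 2 n).
transitivity (GHZ k (fs a) (fs b) * tpow (GHZ k) n (sn a) (sn b)); first by [].
rewrite IH GHZ_const [pdim 2 n.+1]/= natrM invfM.
have E (x : Idx (fun _ : 'I_k => (2 * pdim 2 n)%N)) :
    is_const x = is_const (fs x) && is_const (sn x).
  apply/forallP/andP => [H|[/forallP H1 /forallP H2] i].
    by split; apply/forallP => i; rewrite !mkIE (eqP (H i)).
  have := H1 i; have := H2 i; rewrite !mkIE => /eqP h2 /eqP h1.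
  by rewrite -(mxtens_unindexK (x i)) -(mxtens_unindexK (x i0))
    [mxtens_unindex (x i)]surjective_pairing [mxtens_unindex (x i0)]surjective_pairing h1 h2.
rewrite !E -!mulnb !natrM; ring.
Qed.

(** Several GHZ copies form one GHZ state with $2^n$ levels per party, the form in which they are
    consumed. *)
Lemma tpow_GHZ_kst n :
  tpow (GHZ k) n = kst (@constI (pdim 2 n)) (fun _ _ => (pdim 2 n)%:R^-1).
Proof.
apply: funext => a; apply: funext => b; rewrite tpow_GHZ_const /kst.
rewrite -!sum_eq_constI mulr_suml mulr_sumr; apply: eq_bigr => z _.
by rewrite !mulr_sumr.
Qed.

Lemma GHZ_state : is_state (GHZ k).
Proof.
split.
  pose w x : C := sqrtC 2^-1 * (is_const (D := 2) x)%:R.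
  have -> : GHZ k = fun x y => w x * (w y)^*.
    apply: funext => x; apply: funext => y; rewrite GHZ_const /w rmorphM /=.
    have -> : (sqrtC 2^-1)^* = sqrtC 2^-1 :> C.
      by apply/CrealP; rewrite ger0_real // sqrtC_ge0 invr_ge0 ler0n.
    rewrite -[in LHS](sqrtCK 2^-1) rmorph_nat; ring.
  exact: psd_rank1.
rewrite /tr; under eq_bigr do rewrite GHZ_const -natrM mulnb andbb -sum_eq_constI.
rewrite -mulr_sumr exchange_big /=.
under eq_bigr => z _.
  rewrite (bigD1 (constI z)) //= big1 ?addr0; last by move=> x /negPf ->.
  rewrite eqxx; over.
by rewrite sumr_const card_ord mulVf // pnatr_eq0.
Qed.

End KernelStates.

Lemma ltn_pdim2 n : (n < pdim 2 n)%N.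
Proof. by elim: n => //= n IH; lia. Qed.

(** A uniformly random permutation carries [p] to a uniformly random point: composing with a
    transposition shows that the left sum does not depend on [p], and summing over [p] counts every
    value once per permutation. *)
Lemma sum_perm_eval (T : finType) (G : T -> C) (p : T) :
  #|T|%:R * \sum_(s : {perm T}) G (s p) = #|{perm T}|%:R * \sum_t G t.
Proof.
have E q : \sum_(s : {perm T}) G (s p) = \sum_(s : {perm T}) G (s q).
  rewrite (reindex_inj (mulgI (tperm q p))) /=.
  by apply: eq_bigr => s _; rewrite permM tpermR.
transitivity (\sum_q \sum_(s : {perm T}) G (s q)).
  by rewrite -(eq_bigr _ (fun q _ => E q)) sumr_const mulr_natl.
rewrite exchange_big /=.
rewrite (eq_bigr (fun _ => \sum_t G t)); first by rewrite sumr_const mulr_natl.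
by move=> s _; rewrite [RHS](reindex_inj (@perm_inj _ s)).
Qed.

Section Preparation.
Variable k : nat.
Hypothesis hk : (0 < k)%N.
Variables (d : 'I_k -> nat) (y : kOp d).
Hypothesis sy : is_state y.

Let Z := Idx d.
(** Since $2^{|Z|}>|Z|$, this many GHZ copies have enough levels to encode [Z]. *)
Let D := pdim 2 #|Z|.

Let z0_ex : exists z : Z, true.
Proof.
have [_ ty] := sy; case: (pickP (xpredT : pred Z)) => [z _|Z0]; first by exists z.
have : tr y = 0 by rewrite /tr big_pred0.
by rewrite ty => /eqP; rewrite oner_eq0.
Qed.

Let z0 : Z := xchoose z0_ex.

Let enc (z : Z) : 'I_D := widen_ord (ltnW (ltn_pdim2 #|Z|)) (enum_rank z).
(** Levels outside the image of [enc] decode to the dummy [z0]; [good] singles out the genuine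
    ones. *)
Let dec (p : 'I_D) : Z := odflt z0 [pick z | enc z == p].
Let good (p : 'I_D) := enc (dec p) == p.

Let enc_inj : injective enc.
Proof. by move=> u v /(congr1 val) /= uv; apply: enum_rank_inj; apply: val_inj. Qed.

Let encK : cancel enc dec.
Proof.
move=> z; rewrite /dec; case: pickP => [u /eqP/enc_inj //|/(_ z)].
by rewrite eqxx.
Qed.

Let sum_good (H : Z -> C) : \sum_p (if good p then H (dec p) else 0) = \sum_z H z.
Proof.
rewrite -big_mkcond (reindex_onto enc dec) /=; last by move=> p /eqP.
by apply: eq_big => [z|z _]; rewrite /good encK ?eqxx.
Qed.

(* One party weights the branches |p...p> by phi(s p, s q) for a random permutation s; since
   every p is sent to every position equally often, this is an instrument, and relabelling
   by s gives the same kernel phi for every outcome. *)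
Lemma LOCC_correlate : exists2 L : kOp (fun _ : 'I_k => D) -> kOp (fun _ : 'I_k => #|Z|),
  LOCCchannel L & L (tpow (GHZ k) #|Z|) = kst (fun z : Z => constI k (enum_rank z)) y.
Proof.
have [S yS] := psd_gram (proj1 sy).
pose Psi p l : C := if good p then S (dec p) l else 0.
pose phi p q : C := \sum_l Psi p l * (Psi q l)^*.
have phiE p q : phi p q = if good p then (if good q then y (dec p) (dec q) else 0) else 0.
  rewrite /phi /Psi; case: (good p); last by rewrite big1 // => l _; rewrite mul0r.
  case: (good q); first by rewrite yS.
  by rewrite big1 // => l _; rewrite rmorph0 mulr0.
have phi1 : \sum_p phi p p = 1.
  have [_ <-] := sy; rewrite /tr -sum_good; apply: eq_bigr => p _.
  by rewrite phiE; case: (good p).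
have D0 : D%:R != 0 :> C by rewrite pnatr_eq0 -lt0n (leq_ltn_trans _ (ltn_pdim2 _)).
pose N : C := #|{perm 'I_D}|%:R.
have N0 : N != 0 by rewrite pnatr_eq0 -lt0n; apply/card_gt0P; exists 1%g.
(* Over all [N] permutations each level collects the weight $N/D$ times $\sum_p\phi(p,p)=1$; the
   factor $c^2=D/N$ completes the instrument. *)
pose c : C := sqrtC (D%:R / N).
have cc : c * c = D%:R / N by rewrite -expr2 sqrtCK.
have cJ : c^* = c.
  by apply/CrealP; rewrite ger0_real // sqrtC_ge0 divr_ge0 // ler0n.
pose i0 : 'I_k := Ordinal hk.
(* The index [l] of the Gram factor stays inside the Kraus list of a single outcome and is not
   announced, so the branch of [s] keeps the mixed kernel [phi]. *)
pose K (s : {perm 'I_D}) (i : 'I_k) : seq 'M[C]_(D, D) := if i == i0 then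
  [seq monomial (fun p => c * Psi (s p) l) id | l <- enum Z] else [:: 1%:M].
have HI : LOCCinstr (fun s : {perm 'I_D} => @prodmap k (fun _ => D) (fun _ => D) (fun i => lcp (K s i))).
  apply: (@LOCC_round k (fun _ => D) (fun _ => D) _ i0 K).
  - by move=> i /negPf ii s s'; rewrite /K ii.
  - by move=> i /negPf ii s; rewrite /K ii kraus_sum_id.
  - apply/matrixP => p q; rewrite summxE.
    transitivity (\sum_(s : {perm 'I_D}) D%:R / N * phi (s q) (s p) * (p == q)%:R).
      apply: eq_bigr => s _; rewrite /K eqxx kraus_sum_monomial big_enum /phi mulr_sumr.
      by congr (_ * _); apply: eq_bigr => l _; rewrite rmorphM /= cJ -cc; ring.
    rewrite mxE; case: eqP => [->|_]; last by rewrite big1 // => s _; rewrite mulr0.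
    rewrite -mulr_suml mulr1 -mulr_sumr mulrAC.
    by rewrite -[D in D%:R]card_ord (sum_perm_eval (fun t => phi t t)) phi1 mulr1 divff.
pose h (s : {perm 'I_D}) p := enum_rank (dec (s p)).
(* The relabelling [h s] is injective only on good levels, handled coherently by the operator
   [None]. Each bad level gets its own operator [Some q], which restores trace preservation although
   all bad levels land on [z0]. *)
pose j (s : {perm 'I_D}) (l : option 'I_D) (p : 'I_D) : C :=
  if l is Some q then ((p == q) && ~~ good (s p))%:R else (good (s p))%:R.
pose J (s : {perm 'I_D}) : seq 'M[C]_(#|Z|, D) :=
  [seq monomial (j s l) (h s) | l <- enum {: option 'I_D}].
have sumJ s p q : \sum_l j s l p * (j s l q)^* =
    (good (s p) && good (s q))%:R + ((p == q) && ~~ good (s p))%:R.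
  rewrite (bigD1 None) //= rmorph_nat -natrM mulnb; congr (_ + _).
  rewrite (reindex_onto Some (odflt p)) /=; last by case.
  rewrite (bigD1 p) //= big1 ?addr0; last first.
    by move=> q' /andP[_ /negPf q'p]; rewrite eq_sym q'p mul0r.
  rewrite eqxx rmorph_nat -natrM mulnb eq_sym.
  by case: eqP => [->|] /=; rewrite ?andbF // andbb.
have HJ s : kraus_sum (J s) = 1%:M.
  apply/matrixP => p q; rewrite kraus_sum_monomial big_enum.
  under eq_bigr do rewrite mulrC.
  rewrite sumJ [RHS]mxE eq_sym; case: eqP => [->|pq] /=.
    by rewrite eqxx mulr1 andbb -natrD; case: good.
  rewrite addr0; case: andP => [[gp gq]|]; last by rewrite mul0r.
  rewrite mul1r; case: eqP => // /enum_rank_inj E; case: pq.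
  by apply: (@perm_inj _ s); rewrite -(eqP gp) -(eqP gq) E.
pose L s := @prodmap k (fun _ => D) (fun _ => #|Z|) (fun i => lcp (J s)).
have HL s : LOCCchannel (L s) by apply: LOCC_local.
have H := LOCC_adaptive HI HL.
eexists; first exact: H.
rewrite tpow_GHZ_kst //.
apply: funext => a; apply: funext => b.
pose F p q : C := (a == constI k (enum_rank (dec p)))%:R * (b == constI k (enum_rank (dec q)))%:R.
transitivity (\sum_(s : {perm 'I_D}) \sum_p \sum_q D%:R^-1 * (D%:R / N * phi p q) * F p q).
  apply: eq_bigr => s _.
  have -> : prodmap (fun i => lcp (K s i)) (kst (@constI k D) (fun _ _ => D%:R^-1)) =
      kst (@constI k D) (fun p q => D%:R^-1 * (D%:R / N * phi (s p) (s q))).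
    rewrite (@prodmap_kst k _ _ _ _ _ (@constI k D) _
      (fun i p q => if i == i0 then D%:R / N * phi (s p) (s q) else 1)).
      apply: eq_kst => // p q; congr (_ * _).
      by rewrite (bigD1 i0) //= ?eqxx big1 ?mulr1 // => i /negPf ->.
    move=> p q _ i; rewrite !mkIE /K; case: (i == i0); last by rewrite lcp_id scale1r.
    rewrite lcp_monomial big_enum; congr (_ *: _).
    by rewrite /phi mulr_sumr; apply: eq_bigr => l _; rewrite rmorphM /= cJ -cc; ring.
  rewrite /L (@prodmap_kst k _ _ _ _ _ (fun p => constI k (h s p)) _ (fun _ _ _ => 1)).
    rewrite [RHS](reindex_inj (@perm_inj _ s)); apply: eq_bigr => p _.
    rewrite [RHS](reindex_inj (@perm_inj _ s)); apply: eq_bigr => q _.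
    by rewrite big1 ?mulr1.
  move=> p q pq i; rewrite !mkIE lcp_monomial big_enum sumJ.
  have [gp gq] : good (s p) /\ good (s q).
    by move: pq; rewrite phiE; case: good; case: good => //; rewrite !mulr0 eqxx.
  by rewrite gp gq andbF addr0.
rewrite sumr_const -[LHS]mulr_natl (_ : #|_|%:R = N); last by congr _%:R; apply: eq_card.
rewrite mulr_sumr.
rewrite /kst -[RHS](sum_good (fun z => \sum_w y z w * ((a == constI k (enum_rank z))%:R *
  (b == constI k (enum_rank w))%:R))).
apply: eq_bigr => p _.
have aux (u v w t : C) : u != 0 -> v != 0 -> u * (v^-1 * (v / u * w) * t) = w * t.
  by move=> u0 v0; field; rewrite u0 v0.
have E q := aux _ _ (phi p q) (F p q) N0 D0.
rewrite mulr_sumr; under eq_bigr do rewrite E phiE.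
case: (good p); last by rewrite big1 // => q _; rewrite mul0r.
rewrite -sum_good; apply: eq_bigr => q _.
by case: (good q); rewrite ?mul0r.
Qed.

End Preparation.

(** * Product signs and their orthogonality *)

Section Signs.
Variables (k : nat) (d : 'I_k -> nat).
Let T (i : 'I_k) : finType := 'I_(d i).
Definition signing := {ffun {i : 'I_k & T i} -> bool}.

Definition local_sign (c : signing) (i : 'I_k) (u : 'I_(d i)) : C :=
  (-1) ^+ (c (Tagged T u)).

Definition sign (c : signing) (z : Idx d) : C := \prod_i local_sign c (z i).

Lemma local_sign_sqr c i (u : 'I_(d i)) : local_sign c u * local_sign c u = 1.
Proof. by rewrite -expr2 sqrr_sign. Qed.

Lemma local_sign_conj c i (u : 'I_(d i)) : (local_sign c u)^* = local_sign c u.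
Proof. by rewrite /local_sign rmorph_sign. Qed.

Lemma sign_sqr c z : sign c z * sign c z = 1.
Proof. by rewrite -big_split big1 // => i _; apply: local_sign_sqr. Qed.

Lemma sign_conj c z : (sign c z)^* = sign c z.
Proof. by rewrite rmorph_prod; apply: eq_bigr => i _; apply: local_sign_conj. Qed.

(* Flipping the sign attached to one coordinate where z and w differ negates every term. *)
Lemma sum_sign z w : \sum_c sign c z * sign c w = #|signing|%:R * (z == w)%:R.
Proof.
case: eqP => [->|/eqP]; first by under eq_bigr do rewrite sign_sqr; rewrite sumr_const mulr1.
rewrite -eq_Idx negb_forall => /existsP[l zw]; rewrite mulr0.
pose fl (c : signing) : signing := [ffun u => c u (+) (u == Tagged T (z l))].
have flK : involutive fl.
  by move=> c; apply/ffunP => u; rewrite !ffunE -addbA addbb addbF.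
have flz c : sign (fl c) z = - sign c z.
  rewrite /sign (bigD1 l) //= [X in - X](bigD1 l) //= -mulNr; congr (_ * _).
    rewrite /local_sign ffunE eqxx addbT.
    by case: (c _); rewrite /= ?expr0 ?expr1 ?opprK.
  apply: eq_bigr => i il; rewrite /local_sign ffunE.
  have -> : (Tagged T (z i) == Tagged T (z l)) = false; last by rewrite addbF.
  by apply/negP => /eqP/(congr1 tag) /= E; case/eqP: il.
have flw c : sign (fl c) w = sign c w.
  apply: eq_bigr => i _; rewrite /local_sign ffunE.
  have -> : (Tagged T (w i) == Tagged T (z l)) = false; last by rewrite addbF.
  apply/negP => /eqP E; have il := congr1 tag E; rewrite /= in il.
  subst i; case/eqP: zw; apply/esym/eqP.
  by move/eqP: E; rewrite eq_Tagged.
have E : \sum_c sign c z * sign c w = - \sum_c sign c z * sign c w.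
  rewrite {1}(reindex_inj (inv_inj flK)) -sumrN; apply: eq_bigr => c _.
  by rewrite flz flw mulNr.
by move/eqP: E; rewrite -addr_eq0 -mulr2n mulrn_eq0 => /eqP.
Qed.

End Signs.

(** * Coherent erasure of one party's record of the global index *)

Section Erasure.
Variable k : nat.
Hypothesis hk : (0 < k)%N.
Variables (d e e' : 'I_k -> nat) (j : 'I_k).
Let Z := Idx d.
Variables (X : Z -> Idx e) (Y : Z -> Idx e').
Variables (h : forall i, 'I_(e i) -> 'I_(e' i)) (r : forall i, 'I_(e i) -> Z).
Variable t : forall i, 'I_(e' i) -> 'I_(d i).
Hypothesis hX : forall z i, h (X z i) = Y z i.
Hypothesis h_inj : forall i, i != j -> injective (@h i).
Hypothesis rK : forall p : 'I_(e j), X (r p) j = p.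
Hypothesis Xr : forall z, r (X z j) = z.
Hypothesis tY : forall z i, t (Y z i) = z i.

(* Party j, who knows all of z, measures in a signed basis; the resulting sign is a product
   of signs each of which can be cancelled by the party still holding that coordinate. *)
Lemma LOCC_erase (phi : Z -> Z -> C) :
  exists2 L : kOp e -> kOp e', LOCCchannel L & L (kst X phi) = kst Y phi.
Proof.
pose N : C := #|signing d|%:R.
have N0 : N != 0 by rewrite pnatr_eq0 -lt0n; apply/card_gt0P; exists [ffun _ => true].
(* By [sum_sign] the unnormalised signed measurement sums to [N] times the identity. *)
pose c0 : C := sqrtC N^-1.
have cc : c0 * c0 = N^-1 by rewrite -expr2 sqrtCK.
have cJ : c0^* = c0.
  by apply/CrealP; rewrite ger0_real // sqrtC_ge0 invr_ge0 ler0n.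
pose K (c : signing d) (i : 'I_k) : seq 'M[C]_(e' i, e i) :=
  [seq monomial (fun p => if i == j then c0 * sign c (r p) else 1) (@h i) | l <- [:: tt]].
have r_inj : injective (@r j) by move=> p q E; rewrite -(rK p) -(rK q) E.
have HI : LOCCinstr (fun c : signing d => prodmap (fun i => lcp (K c i))).
  apply: (@LOCC_round k e e' _ j K).
  - by move=> i /negPf ij c c'; rewrite /K ij.
  - move=> i ij c; apply/matrixP => p q; rewrite kraus_sum_monomial big_seq1 (negPf ij).
    rewrite rmorph1 !mul1r (inj_eq (h_inj ij)) mxE; by case: eqP.
  - apply/matrixP => p q; rewrite summxE.
    transitivity (\sum_c N^-1 * (sign c (r p) * sign c (r q)) * (h p == h q)%:R).
      apply: eq_bigr => c _; rewrite kraus_sum_monomial big_seq1 eqxx.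
      by rewrite rmorphM /= cJ sign_conj -cc; ring.
    rewrite -mulr_suml -mulr_sumr sum_sign mulrA mulVf // mul1r (inj_eq r_inj) mxE.
    by case: eqP => [->|]; rewrite ?eqxx ?mulr1 ?mul0r.
pose J (c : signing d) (i : 'I_k) : seq 'M[C]_(e' i, e' i) :=
  [seq monomial (fun p => local_sign c (t p)) id | l <- [:: tt]].
have HJ c i : kraus_sum (J c i) = 1%:M.
  apply/matrixP => p q; rewrite kraus_sum_monomial big_seq1 mxE.
  case: eqP => [->|]; last by rewrite mulr0.
  by rewrite mulr1 local_sign_conj local_sign_sqr.
have HL c : LOCCchannel (prodmap (fun i => lcp (J c i))) := LOCC_local hk (HJ c).
eexists; first exact: (LOCC_adaptive HI HL).
apply: funext => a; apply: funext => b.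
transitivity (\sum_(c : signing d) N^-1 * kst Y phi a b); last first.
  by rewrite sumr_const -[LHS]mulr_natl (_ : #|_|%:R = N) ?mulrA ?divff ?mul1r //; congr _%:R; apply: eq_card.
apply: eq_bigr => c _.
rewrite (@prodmap_kst k _ _ _ _ X Y phi (fun i z w => if i == j then N^-1 * (sign c z * sign c w) else 1)).
  rewrite (@prodmap_kst k _ _ _ _ Y Y _ (fun i z w => local_sign c (z i) * local_sign c (w i))).
    rewrite /kst mulr_sumr; apply: eq_bigr => z _; rewrite mulr_sumr; apply: eq_bigr => w _.
    rewrite [RHS]mulrA; congr (_ * _).
    rewrite (bigD1 j) //= eqxx big1 ?mulr1; last by move=> i /negPf ->.
    rewrite big_split /= -!/(sign c _).
    transitivity (N^-1 * phi z w * ((sign c z * sign c z) * (sign c w * sign c w))).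
      by ring.
    by rewrite !sign_sqr !mulr1.
  by move=> z w _ i; rewrite lcp_monomial big_seq1 !tY local_sign_conj.
move=> z w _ i; rewrite lcp_monomial big_seq1 !hX; congr (_ *: _).
case: eqP => [E|_]; last by rewrite rmorph1 mulr1.
subst i; rewrite !Xr rmorphM /= cJ sign_conj -cc; ring.
Qed.

End Erasure.

(** * From full records of the index to the target state *)

Section Distribution.
Variable k : nat.
Hypothesis hk : (0 < k)%N.
Variables (d : 'I_k -> nat) (y : kOp d).
Hypothesis sy : is_state y.
Let Z := Idx d.

Let Z_ex : exists z : Z, true.
Proof.
have [_ ty] := sy; case: (pickP (xpredT : pred Z)) => [z _|Z0]; first by exists z.
have : tr y = 0 by rewrite /tr big_pred0.
by rewrite ty => /eqP; rewrite oner_eq0.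
Qed.

(** The argument is a natural number because a full record lives in ['I_(partial_dim s i)], which
    agrees with ['I_#|Z|] only through a membership test; [partial_coord] is numeric for the same
    reason. *)
Let zof (p : nat) : Z := nth (xchoose Z_ex) (enum Z) p.

Let zofK (z : Z) : zof (enum_rank z) = z. Proof. exact: nth_enum_rank. Qed.

Let zofV p : (p < #|Z|)%N -> enum_rank (zof p) = p :> nat.
Proof.
move=> pZ; have -> : zof p = enum_val (Ordinal pZ) by apply: set_nth_default; rewrite -cardE.
by rewrite enum_valK.
Qed.

(* The parties in [s] hold their own coordinate of z, the others a full copy of z. *)
Definition partial_dim (s : seq 'I_k) (i : 'I_k) : nat := if i \in s then d i else #|Z|.

Definition partial_coord (s : seq 'I_k) (z : Z) (i : 'I_k) : nat :=
  if i \in s then nat_of_ord (z i) else nat_of_ord (enum_rank z).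

Lemma partial_coord_lt s z i : (partial_coord s z i < partial_dim s i)%N.
Proof. by rewrite /partial_coord /partial_dim; case: ifP. Qed.

Definition partial_index (s : seq 'I_k) (z : Z) : Idx (partial_dim s) :=
  mkI (fun i => Ordinal (partial_coord_lt s z i)).

Lemma partial_indexE s z i : partial_index s z i = partial_coord s z i :> nat.
Proof. by rewrite mkIE. Qed.

(** Induction on the parties that have already given up their record, starting from
    [LOCC_correlate]. By [uniq] the next party still holds all of z, as [LOCC_erase] demands. *)
Lemma LOCC_distribute s : uniq s ->
  exists2 L : kOp (fun _ : 'I_k => pdim 2 #|Z|) -> kOp (partial_dim s),
    LOCCchannel L & L (tpow (GHZ k) #|Z|) = kst (partial_index s) y.
Proof.
elim: s => [|j s IH] /=.
  move=> _; have [L HL E] := LOCC_correlate hk sy.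
  exists L => //; rewrite E.
  apply: (@eq_kst k Z (partial_dim [::]) (fun z => constI k (enum_rank z))) => // z.
  by apply/ffunP => i; apply: val_inj; rewrite mkIE /= partial_indexE.
move=> /andP[js /IH[L HL E]].
pose hval i (p : 'I_(partial_dim s i)) : nat := if i == j then nat_of_ord (zof p i) else nat_of_ord p.
have hlt i p : (@hval i p < partial_dim (j :: s) i)%N.
  rewrite /hval /partial_dim inE; case: (i == j) => //=; exact: (ltn_ord p).
pose tval i (p : 'I_(partial_dim (j :: s) i)) : nat := if i \in j :: s then nat_of_ord p else nat_of_ord (zof p i).
have tlt i p : (@tval i p < d i)%N.
  rewrite /tval; case: ifP => // ij; have := ltn_ord p.
  by rewrite [X in (_ < X)%N -> _]/partial_dim ij.
have pdj : partial_dim s j = #|Z| by rewrite /partial_dim (negPf js).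
have [|||||L' HL' E'] := @LOCC_erase k hk d (partial_dim s) (partial_dim (j :: s)) j
  (partial_index s) (partial_index (j :: s)) (fun i p => Ordinal (hlt i p))
  (fun i p => zof p) (fun i p => Ordinal (tlt i p)) _ _ _ _ _ y.
- move=> z i; apply: val_inj; rewrite /= partial_indexE /hval partial_indexE /partial_coord inE.
  by case: eqP => // ->; rewrite (negPf js) zofK.
- by move=> i /negPf ij p q /(congr1 val); rewrite /= /hval ij => pq; apply: val_inj.
- move=> p; apply: val_inj; rewrite /= partial_indexE /partial_coord (negPf js) zofV //.
  by rewrite -pdj.
- by move=> z; rewrite partial_indexE /partial_coord (negPf js) zofK.
- move=> z i; apply: val_inj; rewrite /= /tval partial_indexE /partial_coord.
  by case: (i \in j :: s) => //; rewrite zofK.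
exists (fun A => L' (L A)); first exact: LOCC_comp.
by rewrite E.
Qed.

(** Once all parties hold just their own coordinate, [kst] runs over the matrix units of the whole
    product basis with coefficients [y]; only the cast from [partial_dim] to [d] remains. *)
Lemma LOCC_of_GHZ :
  exists2 L : kOp (fun _ : 'I_k => pdim 2 #|Z|) -> kOp d,
    LOCCchannel L & L (tpow (GHZ k) #|Z|) = y.
Proof.
have [L HL E] := LOCC_distribute (enum_uniq 'I_k).
have dE i : d i = partial_dim (enum 'I_k) i by rewrite /partial_dim mem_enum.
have HR := LOCC_relabel hk (d := partial_dim (enum 'I_k)) (e := d)
  (F := fun i => cast_ord (esym (dE i))) (G := fun i => cast_ord (dE i))
  (fun i => cast_ordKV (dE i)) (fun i => cast_ordK (dE i)).
eexists; first exact: (LOCC_comp HL HR).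
cbv beta; rewrite E; apply: funext => a; apply: funext => b; rewrite /kst.
have eqa a' z : (mapI (fun i => cast_ord (dE i)) a' == partial_index (enum 'I_k) z) = (a' == z).
  rewrite -!eq_Idx; apply: eq_forallb => i.
  by rewrite -!val_eqE /= partial_indexE mkIE /partial_coord mem_enum.
rewrite (bigD1 a) //= [X in _ + X]big1 ?addr0; last first.
  by move=> z /negPf az; rewrite big1 // => w _; rewrite eqa eq_sym az mul0r mulr0.
rewrite (bigD1 b) //= [X in _ + X]big1 ?addr0; last first.
  by move=> w /negPf bw; rewrite (eqa b w) [b == w]eq_sym bw !mulr0.
by rewrite !eqa !eqxx !mulr1.
Qed.

End Distribution.

Local Open Scope classical_set_scope.

(** * Regularised errors and the rate formula *)

Lemma limn_esup_eq0 (R : realType) (u : nat -> \bar R) : (forall n, 0%E <= u n)%E ->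
  limn_esup u = 0%E <->
  forall eps : R, 0 < eps -> exists N, forall n, (N <= n)%N -> (u n <= eps%:E)%E.
Proof.
move=> u0; rewrite /limn_esup /ereal_normedtype.limf_esup; split=> [E eps e0|H].
  have : (ereal_inf [set ereal_sup (u @` V) | V in \oo] < eps%:E)%E by rewrite E lte_fin.
  move=> /ereal_inf_lt[_ [V [N _ NV] <-] sV]; exists N => n Nn.
  apply: le_trans (ltW sV); apply: ereal_sup_ubound; exists n => //; exact: NV.
apply/eqP; rewrite eq_le; apply/andP; split.
  apply/lee_addgt0Pr => eps e0; rewrite add0e; have [N HN] := H _ e0.
  apply: (@le_trans _ _ (ereal_sup (u @` [set n | (N <= n)%N]))).
    apply: ereal_inf_lbound; exists [set n | (N <= n)%N] => //.
    by exists N.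
  by apply: ge_ereal_sup => _ [n Nn <-]; apply: HN.
apply: le_ereal_inf_tmp => _ [V [N _ NV] <-].
apply: le_trans (u0 N) _; apply: ereal_sup_ubound; exists N => //.
by apply: NV => /=.
Qed.

(** The separation argument compares integral powers of the two states, so a gap between supremum
    and infimum is probed at a rational rate. The upper end may be $+\infty$, which is the infimum
    when no admissible functional exists. *)
Lemma exists_rational_between (R : realType) (a : R) (b : \bar R) : 0 <= a -> (a%:E < b)%E ->
  exists u v : nat, [/\ (0 < v)%N, a < u%:R / v%:R & ((u%:R / v%:R)%:E < b)%E].
Proof.
move=> a0; case: b => [b||//] ab.
  rewrite lte_fin in ab; have ba : 0 < b - a by rewrite subr_gt0.
  have bv : 0 <= (b - a)^-1 by rewrite invr_ge0 ltW.
  have := archi_boundP bv; set v := Num.bound _ => hv.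
  have v0 : 0 < v%:R :> R by apply: le_lt_trans hv.
  have hv' : 1 < (b - a) * v%:R by rewrite mulrC -ltr_pdivrMr // div1r.
  have av0 : 0 <= a * v%:R by rewrite mulr_ge0 // ltW.
  have /andP[h1 h2] := truncn_itv av0.
  exists (Num.truncn (a * v%:R)).+1, v; split.
  - by rewrite -(ltr0n R).
  - by rewrite ltr_pdivlMr.
  - by rewrite lte_fin ltr_pdivrMr // -natr1; lra.
exists (Num.truncn a).+1, 1%N; rewrite divr1 ltry; split => //.
exact: truncnS_gt.
Qed.

(** * Translation between the abstract rate theory and k-partite states *)

Section Main.
Variable k : nat.
Hypothesis hk : (0 < k)%N.

Let M := @state_monoid k.
Let ghz : state k := State (GHZ_state hk).

Lemma opt_err_ge0 (d e : 'I_k -> nat) (rho : kOp d) (sigma : kOp e) :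
  (0%E <= opt_err rho sigma)%E.
Proof. by apply: le_ereal_inf_tmp => _ [eps [e0 _] <-]; rewrite lee_fin. Qed.

Lemma limn_esup_opt_err (x y : nat -> state k) :
  limn_esup (fun n => opt_err (sop (x n)) (sop (y n))) = 0%E <->
  forall eps : Rr, 0 < eps -> exists N, forall n, (N <= n)%N -> convertible eps (x n) (y n).
Proof.
rewrite limn_esup_eq0; last by move=> n; apply: opt_err_ge0.
split=> H eps e0.
  have [e1 e10 He1] := tracedist_of_pdist e0.
  (* The infimum in [opt_err] may not be attained; aiming at [e1 / 2] yields an actual channel with
     error below [e1]. *)
  have e12 : 0 < e1 / 2 by rewrite divr_gt0.
  have [N HN] := H _ e12; exists N => n Nn.
  have : (opt_err (sop (x n)) (sop (y n)) < e1%:E)%E.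
    by apply: le_lt_trans (HN _ Nn) _; rewrite lte_fin; lra.
  move=> /ereal_inf_lt[_ [t [t0 [L [HL pL]]] <-]]; rewrite lte_fin => te.
  exists L => //; apply: He1; [exact: LOCC_state HL (sopP _)|exact: sopP|].
  exact: le_trans pL (ltW te).
have [t t0 Ht] := pdist_of_tracedist e0.
have [N HN] := H _ t0; exists N => n Nn; have [L HL E] := HN _ Nn.
apply: ereal_inf_lbound; exists eps => //; split; first exact: ltW.
exists L; split => //; apply: Ht => //; [exact: LOCC_state HL (sopP _)|exact: sopP].
Qed.

Let asgS := asg (@stens k) (sone k) (@convertible k).

Lemma asym_geqE (x y : state k) : asym_geq (sop x) (sop y) <-> asgS x y.
Proof.
have := limn_esup_opt_err (fun n => spow x n) (fun n => spow y n).
rewrite /asym_geq /asgS /asg /=.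
move=> [h1 h2]; split=> [/h1|] H.
  by move=> eps /H[N HN]; exists N => n /HN; rewrite !spowE.
apply: h2 => eps /H[N HN]; exists N => n /HN; by rewrite !spowE.
Qed.

Lemma achievableE (x y : state k) (r : Rr) : achievable (sop x) (sop y) r <->
  rate_achievable (@stens k) (sone k) (@convertible k) ghz x y r.
Proof.
have E delta := limn_esup_opt_err
  (fun n => stens (spow x n) (spow ghz (nfloor (delta * n%:R))))
  (fun n => spow y (nceil (r * n%:R))).
split=> -[r0 H]; split => // delta d0.
  have [+ _] := E delta => /(_ (H _ d0)) h eps /h[N HN].
  by exists N => n /HN; rewrite !spowE.
have [_ +] := E delta; apply => eps e0; have [N HN] := H _ d0 _ e0.
by exists N => n /HN; rewrite !spowE.
Qed.

Let measure := entanglement_measure (@stens k) (sone k) (@convertible k) ghz.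

Lemma measure_of_Fk (E : kfun k) : Fk E -> measure (fun x => E (sdim x) (sop x)).
Proof.
move=> [Eg [ED Em]]; split => //.
  by move=> a b; apply: ED; apply: sopP.
by move=> a b /asym_geqE; apply: Em; apply: sopP.
Qed.

Lemma Fk_of_measure (E : state k -> Rr) : measure E -> exists2 E' : kfun k, Fk E' &
  forall x, E' (sdim x) (sop x) = E x.
Proof.
move=> [Eg ED Em].
(* A [kfun] takes a value at every operator. Outside the states it is set to 0, which is compatible
   with [Fk] because all its conditions concern states. *)
pose E' : kfun k := fun d A =>
  match pselect (is_state A) with left p => E (State p) | right _ => 0 end.
have EE x : E' (sdim x) (sop x) = E x.
  case: x => d A p; rewrite /E' /=; case: pselect => // q.
  by rewrite (Prop_irrelevance q p).
exists E' => //; split; first by rewrite -Eg -EE.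
split=> [d e rho sigma sr ss|d e rho sigma sr ss H].
  by have := ED (State sr) (State ss); rewrite -!EE.
have := Em (State sr) (State ss); rewrite -!EE; apply.
exact/asym_geqE.
Qed.

Let convG (y : state k) : exists m, convertible 0 (pw (@stens k) (sone k) ghz m) y.
Proof.
have [L HL E] := LOCC_of_GHZ hk (sopP y).
exists #|Idx (sdim y)|; rewrite -spowE.
exact: (@convertible0 k (spow ghz _) y L HL E).
Qed.

Lemma R_LOCCq_states (x y : state k) :
  R_LOCCq (sop x) (sop y) =
  ereal_inf [set ((E _ (sop x) / E _ (sop y))%:E)%E
            | E in [set E : kfun k | Fk E /\ E _ (sop y) != 0]].
Proof.
pose cs := convertible_sim hk; pose ct := @convertible_trans k.
pose cr := @convertible_opr k; pose cl := @convertible_le k.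
pose cd := @convertible_drop k hk.
apply/eqP; rewrite eq_le; apply/andP; split.
  apply: ge_ereal_sup => _ [r /achievableE ach <-].
  apply: le_ereal_inf_tmp => _ [E [FE Ey] <-]; rewrite lee_fin.
  have mE := measure_of_Fk FE.
  have y0 := measure_ge0 M cs ct cr cl cd y mE.
  rewrite ler_pdivlMr ?lt_neqAle ?y0 1?eq_sym ?Ey //.
  exact: (rate_le_measure M cs ct cr cl cd ach mE).
rewrite leNgt; apply/negP => lt.
(* Rate 0 is achieved by discarding everything. This excludes the value $-\infty$ for the supremum
   and makes it nonnegative, as needed for a rational of the form [u / v] with natural [u] and
   [v]. *)
have ach0 : achievable (sop x) (sop y) 0.
  apply/achievableE; split => // delta d0 eps e0; exists 0%N => n _.
  rewrite mul0r ceil0 /=; apply: (cl _ _ _ _ (ltW e0)).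
  exact: (conv0l ct (cs _ _ (sim_sym M (sim1 M _))) (cd _ _)).
have sup0 : (0%E <= R_LOCCq (sop x) (sop y))%E.
  by apply: ereal_sup_ubound; exists 0.
move: (lt) sup0; case ER : (R_LOCCq (sop x) (sop y)) => [s||] //; last by rewrite ltNge leey.
move=> {}lt; rewrite lee_fin => s0.
have [u [v [v0 sr rt]]] := exists_rational_between s0 lt.
have r0 : 0 <= u%:R / v%:R :> Rr by rewrite divr_ge0.
have nach : ~ rate_achievable (@stens k) (sone k) (@convertible k) ghz x y (u%:R / v%:R).
  move=> /achievableE ach.
  have : ((u%:R / v%:R)%:E <= R_LOCCq (sop x) (sop y))%E.
    by apply: ereal_sup_ubound; exists (u%:R / v%:R).
  by rewrite ER lee_fin leNgt sr.
have ruv : u%:R / v%:R * v%:R <= u%:R :> Rr by rewrite divfK // pnatr_eq0 -lt0n.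
have [E [mE Ey Exy]] := measure_of_unachievable M cs ct cr cl cd convG r0 nach v0 ruv.
have [E' FE' EE] := Fk_of_measure mE.
move: rt; rewrite ltNge => /negP; apply.
apply: (@le_trans _ _ ((E' _ (sop x) / E' _ (sop y))%:E)).
  by apply: ereal_inf_lbound; exists E' => //; split => //=; rewrite EE.
by rewrite lee_fin !EE.
Qed.

End Main.

Theorem mainTheorem4 (k : nat) (hk : (0 < k)%N) (d e : 'I_k -> nat)
  (rho : kOp d) (sigma : kOp e) :
  is_state rho -> is_state sigma ->
  R_LOCCq rho sigma =
  ereal_inf [set ((E d rho / E e sigma)%:E)%E
            | E in [set E : kfun k | Fk E /\ E e sigma != 0]].
Proof. by move=> sr ss; exact: (R_LOCCq_states hk (State sr) (State ss)). Qed.
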